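(* Let $L$ be a countably infinite set and consider the edgeless cube $Q_L$. Then: (1) $\mathcal S^{\mathrm{face}}\subsetneq \mathcal L[f_{\mathrm{solved}}]\subseteq \mathcal S$; (2) every configuration in $\mathcal S^{\mathrm{face}}$ is accessible from every configuration in $\mathcal S$ by a basic sequence of length at most $\omega^2$; (3) if $g$ is a legal configuration not in $\mathcal S$ and $f\in\mathcal S$, then $g$ is not accessible from $f$ and $f$ is not accessible from $g$.
   Context: Let $L$ be an infinite set, $-L=\{-r:r\in L\}$ a disjoint copy of $L$, and $0$ a new element; $L^\dagger=-L\cup\{0\}\cup L$ with $-(-r)=r$, $-0=0$. Adjoin $\pm\infty$ with $-(+\infty)=-\infty$ and set $\bar L^\dagger=L^\dagger\cup\{\pm\infty\}$. Points of $U=(\bar L^\dagger)^3$ have coordinates $x,y,z$. The edgeless cube $Q_L$ is the set of cells: points of $U$ with exactly one coordinate in $\{\pm\infty\}$. For $i\in\{x,y,z\}$, $\alpha\in\bar L^\dagger$, the quarter-turn twist $T_{i,\alpha}$ is the permutation of cells fixing every cell $p$ with $p_i\ne\alpha$ and acting on the others by $T_{x,\alpha}(\alpha,y,z)=(\alpha,-z,y)$, $T_{y,\alpha}(x,\alpha,z)=(z,\alpha,-x)$, $T_{z,\alpha}(x,y,\alpha)=(-y,x,\alpha)$; those with $\alpha=\pm\infty$ are face twists. Basic twists are $T,T^2,T^3$ for quarter-turn twists $T$. A basic sequence is a sequence $\langle\sigma_\eta:\eta<\theta\rangle$ of basic twists of ordinal length $\theta$. A configuration is a map $f$ from cells to the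 six colors red, white, green, orange, yellow, blue together with a special value NaC; it is legal if it never takes value NaC. The solved configuration $f_{\mathrm{solved}}$ colors a cell red, blue, white, orange, green, yellow according as $x=+\infty$, $y=+\infty$, $z=+\infty$, $x=-\infty$, $y=-\infty$, $z=-\infty$. A twist $\sigma$ acts by $(\sigma f)(c)=f(\sigma^{-1}c)$. Applying $\langle\sigma_\eta:\eta<\theta\rangle$ to $f_0$ produces $f_{\eta+1}=\sigma_\eta f_\eta$, and for limit $\lambda\le\theta$, $f_\lambda(c)$ is the eventually constant value of $f_\eta(c)$ ($\eta<\lambda$) if it exists and NaC otherwise; $f_\theta$ is the terminal configuration. $f$ is accessible from $f_0$ if it is the terminal configuration of some basic sequence applied to $f_0$. The cluster of a cell $c$ is its orbit under the group generated by all quarter-turn twists. The six center cells (two coordinates equal to $0$) form the center cluster; all other clusters are non-center. A configuration $f$ is standard if it is legal, each non-center cluster contains exactly four cells of each of the six colors, and there is a rotational symmetry $\rho$ of the cube (a map $U\to U$ given by a signed permutation of coordinates of determinant $1$, where the sign acts by the negation on $\bar L^\dagger$) with $f(c)=f_{\mathrm{solved}}(\rho c)$ for every center cell $c$. $\mathcal S$ is the set of standard configurations; $\mathcal S^{\mathrm{face}}$ is the set of standard configurations $f$ with $T f=f$ for every quarter-turn face twist $T$; $\mathcal L[f_{\mathrm{solved}}]$ is the set of legal configurations accessible from $f_{\mathrm{solved}}$. *)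

(* Defs.v *)
From Stdlib Require Import Relations List Lia.
From mathcomp Require Import all_boot fingroup perm zify.

Set Implicit Arguments.
Unset Strict Implicit.
Unset Printing Implicit Defensive.

Section Cube.
Variable L : eqType.

Inductive Ldag := LNeg of L | LZero | LPos of L.
Inductive Bar := Fin of Ldag | PInf | NInf.

Definition negL (a : Ldag) : Ldag :=
  match a with LNeg r => LPos r | LZero => LZero | LPos r => LNeg r end.
Definition negB (b : Bar) : Bar :=
  match b with Fin a => Fin (negL a) | PInf => NInf | NInf => PInf end.

Definition ldag_eqb (a b : Ldag) : bool :=
  match a, b with
  | LNeg r, LNeg s => r == s
  | LZero, LZero => true
  | LPos r, LPos s => r == s
  | _, _ => false
  end.
Definition bar_eqb (a b : Bar) : bool :=
  match a, b with
  | Fin x, Fin y => ldag_eqb x y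
  | PInf, PInf => true
  | NInf, NInf => true
  | _, _ => false
  end.

Lemma bar_eqbP a b : reflect (a = b) (bar_eqb a b).
Proof.
case: a; case: b => //=; try (by constructor);
  try (move=> *; by constructor).
case=> [s||s]; case=> [r||r] /=; try (by constructor);
  try (apply: (iffP eqP) => [->|[]] //).
Qed.

Definition U : Type := (Bar * Bar * Bar)%type.

Definition is_inf (b : Bar) : nat := match b with PInf | NInf => 1 | _ => 0 end.
Lemma is_inf_neg b : is_inf (negB b) = is_inf b. Proof. by case: b. Qed.

Definition is_cell (p : U) : bool :=
  let: (x, y, z) := p in is_inf x + is_inf y + is_inf z == 1.
Definition Cell : Type := {p : U | is_cell p}.

Definition is_zero (b : Bar) : nat := match b with Fin LZero => 1 | _ => 0 end.
Definition is_center (p : U) : bool :=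
  let: (x, y, z) := p in is_zero x + is_zero y + is_zero z == 2.

Inductive axis := AX | AY | AZ.

Definition twistU (i : axis) (al : Bar) (p : U) : U :=
  let: (x, y, z) := p in
  match i with
  | AX => if bar_eqb x al then (x, negB z, y) else (x, y, z)
  | AY => if bar_eqb y al then (z, y, negB x) else (x, y, z)
  | AZ => if bar_eqb z al then (negB y, x, z) else (x, y, z)
  end.

Lemma twistU_cell i al p : is_cell p -> is_cell (twistU i al p).
Proof.
case: p => [[x y] z] /=.
case: i; case: ifP => _ //=; rewrite ?is_inf_neg => /eqP H; apply/eqP.
- by rewrite -H; lia.
- by rewrite -H; lia.
- by rewrite -H; lia.
Qed.

Definition twistC (i : axis) (al : Bar) (c : Cell) : Cell :=
  exist _ (twistU i al (proj1_sig c)) (twistU_cell i al (proj2_sig c)).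

(** colors; [None] is NaC *)
Inductive color := red | white | green | orange | yellow | blue.
Definition config : Type := Cell -> option color.

Definition legal (f : config) : Prop := forall c, f c <> None.

Definition solvedU (p : U) : option color :=
  let: (x, y, z) := p in
  match x, y, z with
  | PInf, _, _ => Some red
  | _, PInf, _ => Some blue
  | _, _, PInf => Some white
  | NInf, _, _ => Some orange
  | _, NInf, _ => Some green
  | _, _, NInf => Some yellow
  | _, _, _ => None
  end.
Definition f_solved : config := fun c => solvedU (proj1_sig c).

(** basic twists: T^(k+1) for k : 'I_3, T = T_{bax, bal} *)
Record btwist := BT { bax : axis; bal : Bar; bk : 'I_3 }.

(** (sigma f)(c) = f (sigma^-1 c), with (T^(k+1))^-1 = T^(3-k) since T^4 = id *)
Definition act (s : btwist) (f : config) : config :=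
  fun c => f (iter (3 - bk s) (twistC (bax s) (bal s)) c).

Definition quarter (i : axis) (al : Bar) : btwist := BT i al ord0.

(** clusters: orbits under the group generated by quarter-turn twists
    (each generator has finite order, so forward reachability suffices) *)
Definition twist_step (c d : Cell) : Prop := exists i al, d = twistC i al c.
Definition cluster (c d : Cell) : Prop := clos_refl_trans Cell twist_step c d.

Definition exactly (n : nat) (P : Cell -> Prop) : Prop :=
  exists s : list Cell, NoDup s /\ length s = n /\ forall d, In d s <-> P d.

(** rotational symmetries: signed permutation of coordinates, det 1 *)
Definition coord (p : U) (j : 'I_3) : Bar :=
  let: (x, y, z) := p in nth PInf [:: x; y; z] j.
Definition sgnB (e : bool) (b : Bar) : Bar := if e then negB b else b.
Definition o0 : 'I_3 := @Ordinal 3 0 isT.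
Definition o1 : 'I_3 := @Ordinal 3 1 isT.
Definition o2 : 'I_3 := @Ordinal 3 2 isT.
(** rho(p)_j = eps_j * p_{sigma j}; the matrix has entries eps_j at (j, sigma j) *)
Definition rotU (sg : 'S_3) (eps : 'I_3 -> bool) (p : U) : U :=
  (sgnB (eps o0) (coord p (sg o0)),
   sgnB (eps o1) (coord p (sg o1)),
   sgnB (eps o2) (coord p (sg o2))).
(** det = sign(sigma) * prod eps_j = 1 *)
Definition det_one (sg : 'S_3) (eps : 'I_3 -> bool) : bool :=
  ~~ (odd_perm sg (+) eps o0 (+) eps o1 (+) eps o2).

Definition standard (f : config) : Prop :=
  legal f /\
  (forall c : Cell, ~~ is_center (proj1_sig c) ->
     forall k : color, exactly 4 (fun d => cluster c d /\ f d = Some k)) /\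
  (exists (sg : 'S_3) (eps : 'I_3 -> bool), det_one sg eps /\
     forall c : Cell, is_center (proj1_sig c) ->
       f c = solvedU (rotU sg eps (proj1_sig c))).

Definition face_fixed (f : config) : Prop :=
  forall (i : axis) (al : Bar), (al = PInf \/ al = NInf) ->
    forall c, act (quarter i al) f c = f c.

Definition standard_face (f : config) : Prop := standard f /\ face_fixed f.

(** Transfinite sequences: an ordinal length theta is represented by a
    well-ordered type I (of order type theta); stages eta <= theta are
    [Some i] (the stage with index i, i.e. the ordinal of {j | j < i})
    and [None] (= theta itself). *)
Record wellorder := WO {
  wcar :> Type;
  wlt : wcar -> wcar -> Prop;
  wlt_irr : forall a, ~ wlt a a;
  wlt_trans : forall a b c, wlt a b -> wlt b c -> wlt a c;
  wlt_tot : forall a b, wlt a b \/ a = b \/ wlt b a;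
  wlt_wf : well_founded wlt }.

Definition slt (I : wellorder) (a b : option I) : Prop :=
  match a, b with
  | Some x, Some y => wlt x y
  | Some _, None => True
  | None, _ => False
  end.
Definition sle (I : wellorder) (a b : option I) : Prop := slt a b \/ a = b.

Definition eventually_const (I : wellorder) (F : option I -> config)
    (eta : option I) (c : Cell) (v : option color) : Prop :=
  exists b, slt b eta /\ forall g, sle b g -> slt g eta -> F g c = v.

Definition is_run (I : wellorder) (s : I -> btwist) (f0 : config)
    (F : option I -> config) : Prop :=
  forall eta : option I,
    ((forall b, ~ slt b eta) -> forall c, F eta c = f0 c) /\
    (forall j : I, slt (Some j) eta -> (forall b, ~ (slt (Some j) b /\ slt b eta)) ->
       forall c, F eta c = act (s j) (F (Some j)) c) /\
    ((exists b, slt b eta) ->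
     (forall j : I, slt (Some j) eta -> exists b, slt (Some j) b /\ slt b eta) ->
     forall c,
       (forall v, eventually_const F eta c v -> F eta c = v) /\
       ((forall v, ~ eventually_const F eta c v) -> F eta c = None)).

Definition accessible (f0 f : config) : Prop :=
  exists (I : wellorder) (s : I -> btwist) (F : option I -> config),
    is_run s f0 F /\ forall c, F None c = f c.

(** lexicographic order on nat * nat has order type omega^2 *)
Definition lexlt (a b : nat * nat) : Prop :=
  (a.1 < b.1)%N \/ (a.1 = b.1 /\ (a.2 < b.2)%N).

(** accessible by a basic sequence of length <= omega^2: the index
    well-order embeds order-preservingly into omega^2 *)
Definition accessible_le_w2 (f0 f : config) : Prop :=
  exists (I : wellorder) (s : I -> btwist) (F : option I -> config),
    is_run s f0 F /\
    (exists e : I -> nat * nat, forall a b, wlt a b -> lexlt (e a) (e b)) /\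
    forall c, F None c = f c.

Definition L_solved (f : config) : Prop := legal f /\ accessible f_solved f.

End Cube.

(* Main.v *)
(* Every twist acts on a cell as a rotation of the whole cube or trivially, so the
   cluster of a non-center cell is a free orbit of the 24 rotations. Since clusters
   are finite, a value that survives to a limit stage is attained on the whole
   cluster before it, hence every property of the restriction to a cluster that is
   invariant under twists passes from the first to the last configuration as soon
   as the latter is legal; this gives (3) and the inclusion in (1).

   For (2), let X turn the slice y = a, and let W be the conjugate by a quarter turn
   of the face x = +oo of the simultaneous turn of all slices y = -b, for b in a set
   B not containing -a. The supports of X and W meet only in the cells (+oo, a, b)
   with b in B, so the commutator of X and W is a product of 3-cycles, one in the
   cluster of each of these cells, and it moves nothing else. Its conjugates by
   rotations of the cube are of the same kind and form a connected family of
   3-cycles, so every even permutation of the 24 positions is realised in all these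
   clusters at once by finitely many turns of sets of slices. Even permutations
   suffice because colors repeat. At level n one solves in this way all clusters
   that involve the n-th slice and only slices of index at least n, using only
   these slices and the faces. Each level has length less than omega^2, and the
   limit exists because a cell is not moved by late slices while the target is
   fixed by the face twists. *)
From HB Require Import structures.
From Stdlib Require Import Relations List Permutation Lia Classical ClassicalEpsilon.
Require Import Defs.
From mathcomp Require Import all_boot fingroup perm zify.

Set Implicit Arguments.
Unset Strict Implicit.
Unset Printing Implicit Defensive.

Local Notation rotation := (option bool * bool * (bool * bool))%type.

(** * The rotation group of the cube *)

Section Rotations.
Variables (X : Type) (neg : X -> X).
Hypothesis negK : involutive neg.

Definition signed (e : bool) (x : X) : X := if e then neg x else x.

(* The rotation [(n, sw, (e0, e1))] permutes the coordinates cyclically by [n],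
   swaps the first two if [sw], and then applies the signs [e0], [e1] and the
   third sign that makes the determinant 1. *)
Definition rotate (r : rotation) (p : X * X * X) : X * X * X :=
  let: (n, sw, (e0, e1)) := r in
  let: (x, y, z) := p in
  let: (x, y, z) := match n with
    | None => (x, y, z)
    | Some false => (y, z, x)
    | Some true => (z, x, y) end in
  let: (x, y, z) := if sw then (y, x, z) else (x, y, z) in
  (signed e0 x, signed e1 y, signed (e0 (+) e1 (+) sw) z).

End Rotations.

Definition rots : seq rotation :=
  [seq (ns, es) | ns <- [seq (n, sw) | n <- [:: None; Some false; Some true],
                                       sw <- [:: false; true]],
                  es <- [seq (e0, e1) | e0 <- [:: false; true],
                                        e1 <- [:: false; true]]].

Lemma mem_rots r : r \in rots.
Proof. by case: r => [[[[]|] []] [[] []]]. Qed.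

Lemma uniq_rots : uniq rots. Proof. by []. Qed.

(** Signed names of the three coordinates. Products of rotations are computed on the generic point
    [frame] and read back by [unframe], which needs only two coordinates because the determinant
    fixes the third. *)
Definition names := (bool * option bool)%type.
Definition negN (s : names) : names := (~~ s.1, s.2).
Definition frame : names * names * names :=
  ((false, None), (false, Some false), (false, Some true)).
Definition unframe (p : names * names * names) : rotation :=
  let: ((e0, m0), (e1, m1), _) := p in
  if m1 == (match m0 with None => Some false | Some false => Some true
            | Some true => None end)
  then (m0, false, (e0, e1)) else (m1, true, (e0, e1)).

Definition rone : rotation := (None, false, (false, false)).
Definition rmul (r s : rotation) : rotation :=
  unframe (rotate negN r (rotate negN s frame)).
Definition rinv (r : rotation) : rotation :=
  head rone [seq s <- rots | rmul s r == rone].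

Lemma negNK : involutive negN. Proof. by case=> e m; rewrite /negN /= negbK. Qed.

Lemma rotate_mul X (neg : X -> X) (negK : involutive neg) r s p :
  rotate neg (rmul r s) p = rotate neg r (rotate neg s p).
Proof.
case: p => [[x y] z].
by case: r => [[[[]|] []] [[] []]]; case: s => [[[[]|] []] [[] []]];
   rewrite /rotate /= /signed ?negK.
Qed.

(** Both sides act alike on [frame], which spares a check of all triples of rotations. *)
Lemma rmulA r s t : rmul r (rmul s t) = rmul (rmul r s) t.
Proof.
have E u v : rmul u v = unframe (rotate negN u (rotate negN v frame)) by [].
by rewrite (E r) (E (rmul r s)) !(rotate_mul negNK).
Qed.

Lemma rmul1 r : rmul r rone = r.
Proof. by rewrite /rmul; case: r => [[[[]|] []] [[] []]]. Qed.
Lemma rmul1l r : rmul rone r = r.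
Proof. by case: r => [[[[]|] []] [[] []]]. Qed.
Lemma rmulV r : rmul r (rinv r) = rone.
Proof. by case: r => [[[[]|] []] [[] []]]. Qed.
Lemma rmulVl r : rmul (rinv r) r = rone.
Proof. by case: r => [[[[]|] []] [[] []]]. Qed.

Lemma rmulI r : injective (rmul r).
Proof. by apply: (can_inj (g := rmul (rinv r))) => s; rewrite rmulA rmulVl rmul1l. Qed.
Lemma rmulIr r : injective (rmul^~ r).
Proof. by apply: (can_inj (g := rmul^~ (rinv r))) => s; rewrite -rmulA rmulV rmul1. Qed.

Definition rquarter (i : axis) : rotation :=
  match i with
  | AX => (Some true, true, (false, true))
  | AY => (Some false, true, (false, false))
  | AZ => (None, true, (true, false))
  end.

Definition rword (w : seq bool) : rotation :=
  foldr (fun b => rmul (rquarter (if b then AX else AY))) rone w.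

(** The quarter turns about x and y generate the group; by enumeration, words of length at most 6
    suffice. *)
Lemma rotation_word r : exists w, r = rword w.
Proof.
suff /hasP[w _ /eqP <-] : has (fun w => rword w == r)
    (flatten [seq iter n (fun s => [seq true :: w | w <- s] ++ [seq false :: w | w <- s])
                    [:: [::]] | n <- iota 0 7]) by exists w.
by case: r => [[[[]|] []] [[] []]].
Qed.

Lemma rotation_ind (P : rotation -> Prop) :
  P rone -> (forall i r, P r -> P (rmul (rquarter i) r)) -> forall r, P r.
Proof.
move=> P1 PM r; have [w ->] := rotation_word r.
by elim: w => //= b w IH; apply: PM.
Qed.

(** The induction may start at any [r]: a word for [r^-1 s] leads from [r] to [s] by right
    multiplications. *)
Lemma rotation_indr (P : rotation -> Prop) (r s : rotation) :
  P r -> (forall t, P t -> P (rmul t (rquarter AX)) /\ P (rmul t (rquarter AY))) -> P s.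
Proof.
move=> Pr PM; have [w E] := rotation_word (rmul (rinv r) s).
rewrite -[s]rmul1l -(rmulV r) -rmulA E.
elim: w r Pr {E} => [|b w IH] r Pr /=; first by rewrite rmul1.
by rewrite rmulA; apply: IH; case: b; case: (PM r Pr).
Qed.

(** * Rotations acting on cells *)

Section Cells.
Variable L : eqType.
Implicit Types (p : U L) (c d : Cell L) (a b : Ldag L) (S : Bar L -> bool).
Local Notation Bar := (Bar L).
Local Notation U := (U L).
Local Notation Cell := (Cell L).
Local Notation config := (config L).

Lemma negLK : involutive (@negL L). Proof. by case. Qed.
Lemma negBK : involutive (@negB L). Proof. by case=> // a; rewrite /= negLK. Qed.

Lemma negL_fix a : negL a = a -> a = LZero L. Proof. by case: a. Qed.

Definition coordU (i : axis) p : Bar :=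
  let: (x, y, z) := p in match i with AX => x | AY => y | AZ => z end.

Lemma cell_inj c d : sval c = sval d -> c = d.
Proof.
case: c d => [p hp] [q hq] /= e; case: q / e hq => hq.
by rewrite (bool_irrelevance hp hq).
Qed.

Lemma is_cell_rotate r p : is_cell (rotate (@negB L) r p) = is_cell p.
Proof.
case: p => [[x y] z]; rewrite /is_cell.
by case: r => [[[[]|] []] [[] []]]; rewrite /= ?is_inf_neg; congr (_ == _); lia.
Qed.

Lemma rotC_cell r c : is_cell (rotate (@negB L) r (sval c)).
Proof. by rewrite is_cell_rotate; exact: (svalP c). Qed.

Definition rotC r c : Cell :=
  exist (fun p => is_cell p) _ (rotC_cell r c).

Lemma rotC_mul r s c : rotC (rmul r s) c = rotC r (rotC s c).
Proof. by apply: cell_inj; rewrite /= (rotate_mul negBK). Qed.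
Lemma rotC1 c : rotC rone c = c.
Proof. by apply: cell_inj; case: c => [[[x y] z] h]. Qed.
Lemma rotCV r c : rotC r (rotC (rinv r) c) = c.
Proof. by rewrite -rotC_mul rmulV rotC1. Qed.
Lemma rotCK r c : rotC (rinv r) (rotC r c) = c.
Proof. by rewrite -rotC_mul rmulVl rotC1. Qed.

(* Infinitely many slices may turn at once: a [turn] is the effect of a sequence of
   length omega, and the basic twists are the turns of a single slice. *)
Definition turn (i : axis) S c : Cell :=
  if S (coordU i (sval c)) then rotC (rquarter i) c else c.

Lemma coordU_quarter i c : coordU i (sval (rotC (rquarter i) c)) = coordU i (sval c).
Proof. by case: c => [[[x y] z] h]; case: i. Qed.

Lemma coordU_turn i S c : coordU i (sval (turn i S c)) = coordU i (sval c).
Proof. by rewrite /turn; case: ifP => // _; rewrite coordU_quarter. Qed.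

Lemma rquarter4 i :
  rmul (rquarter i) (rmul (rquarter i) (rmul (rquarter i) (rquarter i))) = rone.
Proof. by case: i. Qed.

Lemma turn4 i S c : turn i S (turn i S (turn i S (turn i S c))) = c.
Proof.
case h: (S (coordU i (sval c))); last by rewrite /turn !h.
by rewrite /turn !(h, coordU_quarter) -!rotC_mul -!rmulA rquarter4 rotC1.
Qed.

Lemma twistCE i al c : twistC i al c = turn i (fun be => bar_eqb be al) c.
Proof.
apply: cell_inj; rewrite /turn /=; case: c => [[[x y] z] h] /=.
by case: i => /=; case: ifP.
Qed.

Lemma turn_rot i S c : exists r, turn i S c = rotC r c.
Proof.
rewrite /turn; case: ifP => _; first by exists (rquarter i).
by exists rone; rewrite rotC1.
Qed.

(** A twist acts on each single cell as some rotation; conversely, a quarter rotation of a cell is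
    the twist of the slice through that cell. *)
Lemma clusterP c d : cluster c d <-> exists r, d = rotC r c.
Proof.
split.
  elim=> {c d} [c d [i [al ->]]|c|c d e _ [r ->] _ [s ->]].
  - by rewrite twistCE; exact: turn_rot.
  - by exists rone; rewrite rotC1.
  - by exists (rmul s r); rewrite rotC_mul.
case=> r ->; elim/rotation_ind: r => [|i r IH]; first by rewrite rotC1; apply: rt_refl.
apply: (rt_trans _ _ _ _ _ IH); apply: rt_step.
exists i, (coordU i (sval (rotC r c))); rewrite twistCE /turn rotC_mul.
by case: bar_eqbP.
Qed.

Lemma is_center_rot r c : is_center (sval (rotC r c)) = is_center (sval c).
Proof.
have N (b : Bar) : is_zero (negB b) = is_zero b by case: b => // -[].
case: c => [[[x y] z] h]; rewrite /=.
by case: r => [[[[]|] []] [[] []]]; rewrite /= ?N; congr (_ == _); lia.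
Qed.

Lemma face_proof a b : is_cell (PInf L, Fin a, Fin b). Proof. by []. Qed.
Definition face a b : Cell := exist (fun p => is_cell p) _ (face_proof a b).

Lemma face_cell c : exists r a b, c = rotC r (face a b).
Proof.
suff [r [a [b e]]] : exists r a b, rotC r c = face a b.
  by exists (rinv r), a, b; rewrite -e rotCK.
case: c => [[[x y] z] h].
have E r a b : rotate (@negB L) r (x, y, z) = (PInf L, Fin a, Fin b) ->
    exists r a b, rotC r (exist _ (x, y, z) h) = face a b.
  by move=> e; exists r, a, b; apply: cell_inj.
case: x y z h E => [x||] [y||] [z||] // h E.
- by apply: (E (Some true, false, (false, false))).
- by apply: (E (Some true, false, (true, false))).
- by apply: (E (Some false, false, (false, false))).
- by apply: (E (Some false, false, (true, false))).
- by apply: (E (None, false, (false, false))).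
- by apply: (E (None, false, (true, false))).
Qed.

Lemma is_center_face a b : is_center (sval (face a b)) <-> a = LZero L /\ b = LZero L.
Proof. by case: a => [x||x]; case: b => [y||y]; split=> // -[]. Qed.

(** Only the four rotations about the x axis preserve the face x = +oo; the cases list them with the
    condition that the first face coordinate is kept. *)
Lemma rot_face r a b b' : rotC r (face a b) = face a b' ->
  [\/ r = rone /\ b' = b, a = negL b /\ b' = a,
      a = negL a /\ b' = negL b | a = b /\ b' = negL a].
Proof.
move=> /(congr1 sval) /=.
case: r => [[[[]|] []] [[] []]] //= -[] *; subst; rewrite ?negLK //;
  by [constructor 1|constructor 2; rewrite ?negLK|constructor 3; rewrite ?negLK
     |constructor 4; rewrite ?negLK].
Qed.

(** After transport to a face cell, a nontrivial rotation that fixes it forces both face coordinates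
    to be 0. *)
Lemma rotC_free r c : ~~ is_center (sval c) -> rotC r c = c -> r = rone.
Proof.
have [s [a [b ->]]] := face_cell c; rewrite is_center_rot => /negP nc e.
have {e} : rotC (rmul (rinv s) (rmul r s)) (face a b) = face a b.
  by rewrite !rotC_mul e rotCK.
move/rot_face; case.
- case=> e _; rewrite -[r]rmul1 -(rmulV s) rmulA; set t := rmul _ s.
  have <- : rmul s (rmul (rinv s) (rmul r s)) = t by rewrite rmulA rmulV rmul1l.
  by rewrite e rmul1 rmulV.
- case=> h1 h2; subst b; case: nc; apply/is_center_face.
  by move/esym/negL_fix: h1.
- case=> /esym/negL_fix h1 /esym/negL_fix h2; case: nc; exact/is_center_face.
- case=> h1; subst b; move=> /esym/negL_fix h1; case: nc; exact/is_center_face.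
Qed.

Lemma rotC_inj c : ~~ is_center (sval c) -> injective (rotC^~ c).
Proof.
move=> nc r s /= e.
have /(rotC_free nc) : rotC (rmul (rinv s) r) c = c by rewrite rotC_mul e rotCK.
by move/(congr1 (rmul s)); rewrite rmulA rmulV rmul1l rmul1.
Qed.

End Cells.

(** * Connected families of 3-cycles *)

Section ThreeCycles.
Local Open Scope group_scope.
Variable T : finType.
Implicit Types (x y z u v w : T) (A : {set T}) (s t : {perm T}).

Definition cyc x y z : {perm T} := tperm x y * tperm x z.

Lemma cycE x y z : x != y -> y != z -> z != x ->
  [/\ cyc x y z x = y, cyc x y z y = z & cyc x y z z = x].
Proof.
move=> xy yz zx; rewrite /cyc !permM tpermL tpermR tpermL.
split=> //; first by rewrite tpermD // eq_sym.
by rewrite (@tpermD _ x y z) ?tpermR // eq_sym.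
Qed.

Lemma cycD x y z u : u != x -> u != y -> u != z -> cyc x y z u = u.
Proof. by move=> ux uy uz; rewrite permM !tpermD // eq_sym. Qed.

Lemma cycJ x y z s : cyc x y z ^ s = cyc (s x) (s y) (s z).
Proof. by rewrite /cyc conjMg !tpermJ. Qed.

Lemma cycV x y z : (cyc x y z)^-1 = cyc x z y.
Proof. by rewrite /cyc invMg !tpermV. Qed.

(** A 3-cycle is its own conjugate by itself, and this conjugation shifts its entries. *)
Lemma cyc_rot x y z : x != y -> y != z -> z != x -> cyc y z x = cyc x y z.
Proof.
move=> xy yz zx; have [ex ey ez] := cycE xy yz zx.
have <- : cyc x y z ^ cyc x y z = cyc x y z by rewrite conjgE mulKg.
by rewrite cycJ ex ey ez.
Qed.

Variable H : {perm T} -> Prop.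
Hypotheses (H1 : H 1) (HM : forall s t, H s -> H t -> H (s * t)).

(** In a finite group the inverse is a nonnegative power. *)
Lemma H_inv s : H s -> H s^-1.
Proof.
move=> Hs; rewrite -[s^-1]mulg1 -(expg_order s) -(prednK (order_gt0 s)) expgS mulKg.
by elim: (_.-1) => [|n IH]; rewrite ?expg0 // expgS; apply: HM.
Qed.

Lemma H_conj s t : H s -> H t -> H (s ^ t).
Proof. by move=> Hs Ht; rewrite conjgE; apply: HM; [exact: H_inv|exact: HM]. Qed.

Let distinct x y z := [/\ x != y, y != z & z != x].
Let C x y z := distinct x y z /\ H (cyc x y z).

Let C_rot x y z : C x y z -> C y z x.
Proof. by case=> -[xy yz zx] h; split=> //; rewrite cyc_rot. Qed.

Let C_swap x y z : C x y z -> C y x z.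
Proof.
move=> h; have [[xy yz zx] {}h] := C_rot (C_rot h).
by apply: C_rot; split; [split; rewrite eq_sym|rewrite -cycV; apply: H_inv].
Qed.

(** Conjugation by [(x y w)] sends x to y and y to w and fixes z. *)
Let C_turn x y z w : C x y z -> C x y w -> w != z -> C y w z.
Proof.
case=> -[xy yz zx] h [[_ yw wx]] k wz; split; first by split=> //; rewrite eq_sym.
have [ex ey _] := cycE xy yw wx.
have <- : cyc x y z ^ cyc x y w = cyc y w z.
  by rewrite cycJ ex ey cycD // eq_sym.
exact: H_conj.
Qed.

Let full A := forall x y z, x \in A -> y \in A -> z \in A -> distinct x y z -> C x y z.

(** Conjugating by cycles inside [A] replaces the two old points of [(x y z)] by any two points of
    [A], first with one of them kept in {x, y}, then in general. *)
Let full_grow2 A x y z : full A -> x \in A -> y \in A -> z \notin A -> C x y z ->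
  full (z |: A).
Proof.
move=> fA xA yA zA h.
have zn u : u \in A -> u != z by move=> uA; apply: contra zA => /eqP <-.
have step p q w : p \in A -> q \in A -> w \in A -> w != p -> w != q ->
    C p q z -> C q w z.
  move=> pA qA wA wp wq hpq; apply: (C_turn (x := p)) => //; last exact: zn.
  by apply: fA => //; split=> //; [case: hpq => -[]|rewrite eq_sym].
have K1 u v : u \in [:: x; y] -> v \in A -> u != v -> C u v z.
  rewrite !inE => /orP[]/eqP -> vA.
  - case: (eqVneq v y) => [-> //|vy] xv.
    by apply: (step y x v) => //; [rewrite eq_sym|apply: C_swap].
  - case: (eqVneq v x) => [-> //|vx] xv; first exact: C_swap.
    by apply: (step x y v) => //; rewrite eq_sym.
have K u v : u \in A -> v \in A -> u != v -> C u v z.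
  move=> uA vA uv; case: (boolP (u \in [:: x; y])) => [/K1 hu|]; first exact: hu.
  case: (boolP (v \in [:: x; y])) => [/K1 hv _|].
    by apply: C_swap; apply: hv => //; rewrite eq_sym.
  rewrite !inE !negb_or => /andP[vx vy] /andP[ux uy].
  apply: (step x u v) => //; first by rewrite eq_sym.
  by apply: K1; rewrite ?inE ?eqxx // eq_sym.
move=> u v w; rewrite !in_setU1 => /orP[/eqP->|uA] /orP[/eqP->|vA] /orP[/eqP->|wA] [uv vw wu];
  rewrite ?eqxx // in uv vw wu *; last by apply: fA.
- exact/C_rot/C_rot/K.
- exact/C_rot/K.
- exact: K.
Qed.

(** The conjugate of [(x y z)] by [(x u v)] is [(u y z)]; the two together yield [(x y u)]. Hence y
    and then z can be added by [full_grow2]. *)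
Let full_grow1 A x y z u v : full A -> x \in A -> u \in A -> v \in A -> distinct x u v ->
  y \notin A -> z \notin A -> C x y z -> full (z |: (y |: A)).
Proof.
move=> fA xA uA vA duv yA zA h.
have [[xy yz zx] hxyz] := h; have [xu uv vx] := duv.
have ny w : w \in A -> w != y by move=> wA; apply: contra yA => /eqP <-.
have nz w : w \in A -> w != z by move=> wA; apply: contra zA => /eqP <-.
have Cuyz : C u y z.
  split; first by split=> //; [exact: ny|rewrite eq_sym; exact: nz].
  have [ex _ _] := cycE xu uv vx.
  have <- : cyc x y z ^ cyc x u v = cyc u y z.
    by rewrite cycJ ex !cycD // eq_sym ?ny ?nz.
  by apply: H_conj => //; case: (fA _ _ _ xA uA vA duv).
have Cxyu : C x y u.
  have h1 : C z y u by exact/C_swap/C_rot.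
  have h2 : C z y x by exact/C_swap/C_rot.
  by apply/C_swap; apply: (C_turn h1 h2).
have fy : full (y |: A).
  by apply: (full_grow2 (x := x) (y := u)) => //; exact/C_swap/C_rot/C_rot.
apply: (full_grow2 (x := x) (y := y)) => //; rewrite ?in_setU1 ?xA ?eqxx ?orbT //.
by rewrite negb_or zA andbT eq_sym.
Qed.

(* A set on which all 3-cycles are available can be enlarged along any available
   3-cycle that meets it, so by connectedness it grows to the whole of [T]. *)
Lemma connected_cyc (x0 y0 z0 : T) :
  x0 != y0 -> y0 != z0 -> z0 != x0 -> H (cyc x0 y0 z0) ->
  (forall A, x0 \in A ->
     (forall x y z, x != y -> y != z -> z != x -> H (cyc x y z) ->
        x \in A -> y \in A /\ z \in A) -> forall u, u \in A) ->
  forall x y z, x != y -> y != z -> z != x -> H (cyc x y z).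
Proof.
move=> xy yz zx h0 conn.
have C0 : C x0 y0 z0 by [].
(* Induction on the size of the complement of a set that contains the initial cycle. *)
suff G n : forall A, (#|~: A| <= n)%N -> full A -> x0 \in A -> y0 \in A -> z0 \in A ->
    forall x y z, distinct x y z -> C x y z.
  move=> x y z xy' yz' zx'.
  suff h : C x y z by case: h.
  apply: (G _ [set x0; y0; z0] (leqnn _)) => //; rewrite ?inE ?eqxx ?orbT //.
  move=> u v w; rewrite !inE -!orbA.
  move=> /or3P[] /eqP-> /or3P[] /eqP-> /or3P[] /eqP-> [uv vw wu];
    rewrite ?eqxx // in uv vw wu *; (do ? [by []|exact/C_swap|exact/C_rot|exact/C_rot/C_rot
     |exact/C_swap/C_rot|exact/C_swap/C_rot/C_rot]).
elim: n => [|n IH] A cA fA xA yA zA.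
  move=> x y z d; apply: fA => //; apply/negPn; rewrite -in_setC;
  by move: cA; rewrite leqn0 cards_eq0 => /eqP ->; rewrite inE.
have card_lt A' u : A \subset A' -> u \in A' -> u \notin A -> (#|~: A'| <= n)%N.
  move=> sA uA' uA; rewrite -ltnS; apply: leq_trans cA; apply: proper_card.
  apply/properP; split; first by rewrite setCS.
  by exists u; rewrite inE // uA'.
have grow x y z : x \in A -> y \in A -> z \notin A -> C x y z ->
    forall x y z, distinct x y z -> C x y z.
  move=> x_A y_A z_A h; apply: (IH (z |: A)); rewrite ?in_setU1 ?xA ?yA ?zA ?orbT //.
    by apply: (card_lt _ z) => //; rewrite ?subsetU1 // setU11.
  exact: (full_grow2 fA x_A y_A z_A h).
(* Either some available cycle leaves [A], and [A] grows, or [conn] makes [A] everything. *)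
case: (classic (exists x y z, [/\ C x y z, x \in A & ~ (y \in A /\ z \in A)])).
  move=> [x [y [z [h x_A nyz]]]].
  case: (boolP (y \in A)) => [y_A|y_A]; case: (boolP (z \in A)) => [z_A|z_A].
  - by case: nyz.
  - exact: (grow x y z).
  - by apply: (grow z x y) => //; exact/C_rot/C_rot.
  - have [u [v [uA vA d]]] : exists u v, [/\ u \in A, v \in A & distinct x u v].
      case: (eqVneq x x0) => [->|n0]; first by exists y0, z0.
      case: (eqVneq x y0) => [->|n1]; first by exists z0, x0.
      by exists x0, y0; split=> //; split=> //; rewrite eq_sym.
    apply: (IH (z |: (y |: A))); rewrite ?in_setU1 ?xA ?yA ?zA ?orbT //.
      apply: (card_lt _ z) => //; last by rewrite setU11.
      by apply: subset_trans (subsetU1 _ _); apply: subsetU1.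
    exact: (full_grow1 fA x_A uA vA d).
move=> no.
have all u : u \in A.
  apply: conn => // x y z xy' yz' zx' h x_A; apply: NNPP => nyz.
  by case: no; exists x, y, z; split.
by move=> x y z d; apply: fA.
Qed.

(** An even permutation is a product of pairs of transpositions. A pair with a common point is a
    3-cycle or trivial; other pairs reduce to this by inserting [(y z)] twice. *)
Lemma even_perm_cyc :
  (forall x y z, x != y -> y != z -> z != x -> H (cyc x y z)) ->
  forall s, ~~ odd_perm s -> H s.
Proof.
move=> hC.
have P3 x y z : x != y -> y != z -> H (tperm x y * tperm y z).
  move=> xy yz; case: (eqVneq z x) => [->|zx].
    by rewrite [tperm y x]tpermC tperm2.
  by rewrite [tperm x y]tpermC; apply: hC => //; rewrite eq_sym.
have P2 x y z w : x != y -> z != w -> H (tperm x y * tperm z w).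
  move=> xy; case: (eqVneq y z) => [<-|yz]; last first.
    move=> zw.
    have -> : tperm x y * tperm z w = (tperm x y * tperm y z) * (tperm y z * tperm z w).
      by rewrite mulgA -(mulgA (tperm x y)) tperm2 mulg1.
    by apply: HM; apply: P3.
  by move=> yw; apply: P3.
move=> s; have [ts -> dts] := prod_tpermP s.
elim: {s} (size ts) {-2}ts (leqnn (size ts)) dts => [|n IH] [|[x y] [|[z w] l]] //=.
- by rewrite big_nil.
- by rewrite big_nil.
- by move=> _ /andP[xy _]; rewrite big_seq1 odd_tperm /= xy.
- move=> sz /andP[xy /andP[zw dl]]; rewrite !big_cons mulgA odd_permM => ev.
  apply: HM; first exact: P2.
  apply: IH => //; first exact: ltnW.
  by move: ev; rewrite odd_permM !odd_tperm /= xy zw.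
Qed.

End ThreeCycles.

(** * Simultaneous 3-cycles in infinitely many clusters *)

(** [P] contains every cell of [SX] that [W] moves. As [X] takes [P] off [P] and [W] takes it out of
    [SX], most factors of the commutator are idle at each cell, and what remains is the cycle p, X
    p, W p. *)
Lemma commutator_cycle (A : Type) (X X' W W' : A -> A) (SX P : A -> Prop) :
  cancel X X' -> cancel X' X -> cancel W W' -> cancel W' W ->
  (forall c, ~ SX c -> X c = c) ->
  (forall c, SX c -> ~ P c -> W c = c) ->
  (forall c, SX (X c) <-> SX c) ->
  (forall c, P c -> [/\ SX c, ~ P (X c) & ~ SX (W c)]) ->
  let w c := X (W (X' (W' c))) in
  (forall c, P c -> [/\ w c = X c, w (X c) = W c & w (W c) = c]) /\
  (forall c, (forall p, P p -> [/\ c <> p, c <> X p & c <> W p]) -> w c = c).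
Proof.
move=> XK X'K WK W'K hX hW hSX hP w.
have SX' c : SX (X' c) <-> SX c by have := hSX (X' c); rewrite X'K => -[h1 h2]; split.
have X'fix c : ~ SX c -> X' c = c by move=> h; rewrite -{1}(hX c h) XK.
have W'fix c : SX c -> ~ P c -> W' c = c.
  by move=> h1 h2; rewrite -{1}(hW c h1 h2) WK.
(* If the preimage under [W] were in [SX], then [W] would either take it out of [SX] or fix it, and
   both are impossible. *)
have nW' c : P c -> ~ SX (W' c).
  move=> pc h; case: (hP c pc) => sc _ nsw.
  case: (classic (P (W' c))) => [/hP[_ _]|np]; first by rewrite W'K.
  by move: (hW _ h np); rewrite W'K => e; move: nsw; rewrite {1}e W'K.
split=> [c pc|c hc]; rewrite /w.
  case: (hP c pc) => sc npx nsw; split.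
  - by rewrite X'fix ?W'K //; exact: nW'.
  - have sx : SX (X c) by case: (hSX c) => _; apply.
    by rewrite W'fix // XK hX.
  - rewrite WK; have sx : SX (X' c) by apply/SX'.
    rewrite hW ?X'K // => px; case: (hP _ px) => _ npxx _.
    by apply: npxx; rewrite X'K.
case: (classic (SX c)) => sc.
  have npc : ~ P c by move=> /hc[].
  rewrite W'fix // hW ?X'K //; first exact/SX'.
  by move=> /hc[_ h _]; apply: h; rewrite X'K.
have nsw : ~ SX (W' c).
  move=> h; case: (classic (P (W' c))) => [/hc[_ _ e]|np]; first by apply: e; rewrite W'K.
  by move: (hW _ h np); rewrite W'K => e; rewrite -e in h.
by rewrite X'fix // W'K hX.
Qed.

(** * Finite words of simultaneous turns *)

Section Words.
Variables (L : eqType) (rk : L -> nat).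
Hypothesis rk_inj : injective rk.
Local Notation Bar := (Bar L).
Local Notation Cell := (Cell L).
Local Notation Ldag := (Ldag L).
Local Notation turn_block := (axis * (Bar -> bool))%type.

Definition idx (a : Ldag) : nat :=
  match a with LZero => 0 | LPos l => (rk l).+1 | LNeg l => (rk l).+1 end.

Lemma idx_neg a : idx (negL a) = idx a. Proof. by case: a. Qed.

Lemma idx_eq a b : idx a = idx b -> a = b \/ a = negL b.
Proof.
by case: a => [x||x]; case: b => [y||y] //=; do ?[move=> [/rk_inj ->]]; auto.
Qed.

(** Infinite coordinates are late at every level, so that the faces stay available throughout. *)
Definition late (n : nat) (be : Bar) : bool := if be is Fin a then n <= idx a else true.

Lemma late_neg n be : late n (negB be) = late n be.
Proof. by case: be => //= a; rewrite idx_neg. Qed.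

Definition valid (n : nat) (u : turn_block) : Prop := forall be, u.2 be -> late n be.

(** The head acts last on cells, hence first on configurations, which are composed with [wmap l]. *)
Fixpoint wmap (l : seq turn_block) (c : Cell) : Cell :=
  if l is u :: l' then turn u.1 u.2 (wmap l' c) else c.

Lemma wmap_cat l1 l2 c : wmap (l1 ++ l2) c = wmap l1 (wmap l2 c).
Proof. by elim: l1 => //= u l1 ->. Qed.

Definition achievable (n : nat) (w : Cell -> Cell) : Prop :=
  exists l, List.Forall (valid n) l /\ forall c, w c = wmap l c.

Lemma achievable_id n : achievable n id. Proof. by exists [::]; split; first by constructor. Qed.

Lemma achievable_comp n w1 w2 : achievable n w1 -> achievable n w2 -> achievable n (w1 \o w2).
Proof.
move=> [l1 [v1 e1]] [l2 [v2 e2]]; exists (l1 ++ l2); split.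
  by apply/List.Forall_app.
by move=> c; rewrite wmap_cat /= e1 e2.
Qed.

Lemma achievable_turn n i (S : Bar -> bool) : (forall be, S be -> late n be) -> achievable n (turn i S).
Proof. by move=> v; exists [:: (i, S)]; split=> //; constructor=> //; constructor. Qed.

(** This is the commutator of x with [f^3 y f], where third powers stand for the inverses of
    turns. *)
Lemma achievable_commutator n x f y : achievable n x -> achievable n f -> achievable n y ->
  achievable n (fun c => x (f (f (f (y (f (x (x (x (f (f (f (y (y (y (f c)))))))))))))))).
Proof.
move=> ax af ay.
have a3 w : achievable n w -> achievable n (w \o (w \o w)).
  by move=> aw; apply: achievable_comp => //; apply: achievable_comp.
have aW := achievable_comp (a3 _ af) (achievable_comp ay af).
have aW' := achievable_comp (a3 _ af) (achievable_comp (a3 _ ay) af).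
exact: (achievable_comp ax (achievable_comp aW (achievable_comp (a3 _ ax) aW'))).
Qed.

Lemma achievable_iter n k w : achievable n w -> achievable n (iter k w).
Proof.
move=> aw; elim: k => [|k IH] /=; first exact: achievable_id.
exact: (achievable_comp aw IH).
Qed.

Lemma iter_turn k i (S : Bar -> bool) (c : Cell) :
  iter k (turn i S) c =
  if S (coordU i (sval c)) then iter k (rotC (rquarter i)) c else c.
Proof.
case h: (S _); elim: k => //= k ->; rewrite /turn ?h //.
suff -> : coordU i (sval (iter k (rotC (rquarter i)) c)) = coordU i (sval c) by rewrite h.
by elim: k => // k <-; rewrite /= coordU_quarter.
Qed.

(** The conjugate turns about the image axis; if that axis is reversed, the slices are negated and
    the turn becomes its inverse, whence [k] = 3. *)
Lemma turn_conj j i (S : Bar -> bool) : exists i' k (S' : Bar -> bool),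
  (S' = S \/ S' = (fun be => S (negB be))) /\
  forall c, iter k (turn i' S') (rotC (rquarter j) c) = rotC (rquarter j) (turn i S c).
Proof.
pose S' be := S (negB be).
suff [i' [k [b h]]] : exists i' k (b : bool), forall c,
    iter k (turn i' (if b then S' else S)) (rotC (rquarter j) c) =
    rotC (rquarter j) (turn i S c).
  by exists i', k, (if b then S' else S); split=> //; case: (b); [right|left].
case: j; case: i;
  [exists AX, 1, false | exists AZ, 1, false | exists AY, 3, true
  |exists AZ, 3, true | exists AY, 1, false | exists AX, 1, false
  |exists AY, 1, false | exists AX, 3, true | exists AZ, 1, false] => c;
  rewrite iter_turn; apply: cell_inj; case: c => [[[x y] z] h]; rewrite /turn /S' /= ?negBK;
  by case: (S _) => //=; rewrite /= ?negBK.
Qed.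

Lemma achievable_conj n r w : achievable n w ->
  exists w', achievable n w' /\ forall c, w' (rotC r c) = rotC r (w c).
Proof.
move=> aw; elim/rotation_ind: r => [|i r [w' [aw' e]]].
  by exists w; split=> // c; rewrite !rotC1.
suff [w'' [aw'' e'']] : exists w'', achievable n w'' /\
    forall c, w'' (rotC (rquarter i) c) = rotC (rquarter i) (w' c).
  by exists w''; split=> // c; rewrite !rotC_mul e'' e.
case: aw' => l [vl el]; elim: l vl w' {e} el => [|u l IH] vl w' el.
  by exists id; split; [exact: achievable_id|move=> c; rewrite el].
inversion vl as [|? ? vu vl']; subst.
have [w1 [a1 e1]] := IH vl' (wmap l) (fun=> erefl).
have [i' [k [S' [hS e2]]]] := turn_conj i u.1 u.2.
exists (iter k (turn i' S') \o w1); split.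
  apply: achievable_comp => //; apply: achievable_iter; apply: achievable_turn => be.
  by case: hS => -> /vu; rewrite ?late_neg.
by move=> c; rewrite /= e1 e2 el.
Qed.

(** * The clusters of [face a b] for fixed a and varying b *)

Section Family.
Variables (n : nat) (a : Ldag) (D : Ldag -> Prop).
Hypothesis late_a : late n (Fin a).
Hypothesis late_D : forall b, D b -> late n (Fin b).
Hypothesis D_neg : forall b, D b -> b <> negL a.
Hypothesis D_zero : a = LZero L -> forall b, D b -> ~ D (negL b).

(** Positions in the cluster of [face a b] are labelled by rotations, so that one permutation of the
    24 labels prescribes the same move in every cluster. *)
Definition realizes (B : Ldag -> bool) (t : {perm rotation}) (w : Cell -> Cell) : Prop :=
  (forall b r, B b -> w (rotC r (face a b)) = rotC (t r) (face a b)) /\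
  (forall c, (forall b r, B b -> c <> rotC r (face a b)) -> w c = c).

(** A single word must serve an arbitrary, possibly infinite, subset [B], so that clusters with
    different needs can be treated separately. *)
Definition realizable (t : {perm rotation}) : Prop :=
  forall B : Ldag -> bool, (forall b, B b -> D b) -> exists w, achievable n w /\ realizes B t w.

(** By [rot_face], a coincidence needs a partner equal to -a or, for a = 0, b' = -b; [D_neg] and
    [D_zero] exclude these. *)
Lemma family_inj b b' r r' : D b -> D b' ->
  rotC r (face a b) = rotC r' (face a b') -> b = b' /\ r = r'.
Proof.
move=> Db Db' e.
have /rot_face : rotC (rmul (rinv r') r) (face a b) = face a b'.
  by rewrite rotC_mul e rotCK.
case=> [[h ->]|[h _]|[/esym/negL_fix h e']|[h e']].
- by split=> //; move/(congr1 (rmul r')): h; rewrite rmulA rmulV rmul1l rmul1.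
- by case: (D_neg Db); rewrite h negLK.
- by case: (D_zero h Db); rewrite -e'.
- by case: (D_neg Db').
Qed.

Lemma realizable1 : realizable 1%g.
Proof.
move=> B hB; exists id; split; first exact: achievable_id.
by split=> // b r _; rewrite perm1.
Qed.

Lemma realizableM s t : realizable s -> realizable t -> realizable (s * t)%g.
Proof.
move=> hs ht B hB; have [w [aw [w1 w2]]] := hs B hB; have [v [av [v1 v2]]] := ht B hB.
exists (v \o w); split; first exact: achievable_comp.
split=> [b r Bb|c hc] /=; first by rewrite w1 // v1 // permM.
by rewrite w2 // v2.
Qed.

(** Conjugating the word by the rotation [r] multiplies the labels by [r] on the left. *)
Lemma realizable_cycJ x y z r : realizable (cyc x y z) ->
  realizable (cyc (rmul r x) (rmul r y) (rmul r z)).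
Proof.
move=> h B hB; have [w [aw [w1 w2]]] := h B hB.
have [w' [aw' e]] := achievable_conj r aw.
pose p := perm (@rmulI r); have -> : cyc (rmul r x) (rmul r y) (rmul r z) = (cyc x y z ^ p)%g.
  by rewrite cycJ !permE.
exists w'; split=> //; split=> [b s Bb|c hc].
  rewrite -[s]rmul1l -(rmulV r) -rmulA; set u := rmul _ s.
  rewrite rotC_mul e w1 // -rotC_mul; congr rotC.
  have -> : rmul r u = p u by rewrite permE.
  by rewrite permJ /p [RHS]permE.
rewrite -[c](rotCV r) e w2 // => b s Bb ec; apply: (hc b (rmul r s) Bb).
by rewrite rotC_mul -ec rotCV.
Qed.

Let qX := rquarter AX.
Let qY := rquarter AY.

Lemma realizable_base : realizable (cyc rone qY (rmul qY qX)).
Proof.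
move=> B hB.
pose X := turn AY (fun be => bar_eqb be (Fin a)).
pose F := turn AX (fun be => bar_eqb be (PInf L)).
pose Y := turn AY (fun be => if be is Fin z then B (negL z) else false).
pose W (c : Cell) := F (F (F (Y (F c)))).
pose W' (c : Cell) := F (F (F (Y (Y (Y (F c)))))).
pose P c := exists2 b, B b & c = face a b.
pose SX (c : Cell) := coordU AY (sval c) = Fin a.
have XK c : X (X (X (X c))) = c by exact: turn4.
have FK c : F (F (F (F c))) = c by exact: turn4.
have YK c : Y (Y (Y (Y c))) = c by exact: turn4.
have Xf b : X (face a b) = rotC qY (face a b).
  by rewrite /X /turn [coordU _ _]/= ; case: bar_eqbP.
(* [F] brings (+oo, a, b) to (+oo, -b, a), and [Y] then takes it off the face, so the final [F^3]
   does not move it. *)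
have Wf b : B b -> W (face a b) = rotC (rmul qY qX) (face a b).
  move=> Bb; rewrite rotC_mul.
  have E1 : F (face a b) = rotC qX (face a b) by [].
  have E2 : Y (F (face a b)) = rotC qY (rotC qX (face a b)).
    by rewrite E1 /Y /turn /= negLK Bb.
  by rewrite /W E2 !/F /turn.
have [] := @commutator_cycle _ X (fun c => X (X (X c))) W W' SX P; rewrite /W /W'.
- by [].
- by [].
- by move=> c; rewrite FK YK FK.
- by move=> c; rewrite FK YK FK.
- by move=> c h; rewrite /X /turn; case: bar_eqbP.
(* Off the face, [F] is idle and [Y] avoids y = a since -a is not in [B]. At (+oo, a, z), [F] leads
   to y = -z, which [Y] turns only if z is in [B]. *)
- move=> c sc nP; case: c sc nP => [[[x y] z] h] sc nP; rewrite /SX /= in sc; subst y.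
  have Fx : x <> PInf L -> F (exist (fun p => is_cell p) (x, Fin a, z) h) =
      exist (fun p => is_cell p) (x, Fin a, z) h.
    by move=> hx; rewrite /F /turn /=; case: bar_eqbP.
  case: x h nP Fx => [x||] h nP Fx.
  + rewrite Fx // /Y {1}/turn /=; case: ifP => [/hB/D_neg //|_].
    by rewrite !Fx.
  + case: z h nP Fx => [z||] h nP Fx //.
    have nB : B z = false.
      by apply/negP => Bz; apply: nP; exists z => //; apply: cell_inj.
    rewrite /Y [turn AY _ _]/turn /= negLK nB; exact: FK.
  + rewrite Fx // /Y {1}/turn /=; case: ifP => [/hB/D_neg //|_].
    by rewrite !Fx.
- by move=> c; rewrite /SX /X coordU_turn.
(* [X] takes the cell off the face; [W] puts it on the slice y = -b, which differs from y = a. *)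
- move=> c [b Bb ->]; split=> //.
  + by rewrite Xf => -[b' _] /(congr1 sval).
  + rewrite -/(W _) Wf // /SX /= => -[e]; apply: (D_neg (hB _ Bb)).
    by rewrite -e negLK.
move=> h1 h2; pose w (c : Cell) := X (W (X (X (X (W' c))))).
have {}h1 c : P c -> [/\ w c = X c, w (X c) = W c & w (W c) = c] by exact: h1.
have {}h2 c : (forall p, P p -> [/\ c <> p, c <> X p & c <> W p]) -> w c = c by exact: h2.
have h1' b : B b -> [/\ w (face a b) = rotC qY (face a b),
    w (rotC qY (face a b)) = rotC (rmul qY qX) (face a b)
    & w (rotC (rmul qY qX) (face a b)) = face a b].
  move=> Bb; have [] := h1 (face a b); first by exists b.
  by rewrite Xf -/(W _) Wf.
have aX : achievable n X by apply: achievable_turn => be /bar_eqbP ->.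
have aF : achievable n F by apply: achievable_turn => be /bar_eqbP ->.
have aY : achievable n Y.
  by apply: achievable_turn => -[z||] //= /hB/late_D /=; rewrite idx_neg.
exists w; split; first exact: achievable_commutator.
split=> [b r Bb|c hc].
  have [e1 e2 e3] := h1' b Bb.
  have [t1 t2 t3] := @cycE _ rone qY (rmul qY qX) isT isT isT.
  case: (eqVneq r rone) => [->|r1]; first by rewrite t1 rotC1.
  case: (eqVneq r qY) => [->|r2]; first by rewrite t2.
  case: (eqVneq r (rmul qY qX)) => [->|r3]; first by rewrite t3 rotC1.
  rewrite cycD //; apply: h2 => p [b' Bb' ->].
  have N s : r != s -> rotC r (face a b) <> rotC s (face a b').
    by move=> /eqP rs /family_inj[]; try exact: hB.
  split; first by rewrite -[face a b']rotC1; exact: N.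
    by rewrite Xf; exact: N.
  by rewrite -/(W _) Wf //; exact: N.
apply: h2 => p [b Bb ->]; split.
- by rewrite -[face a b]rotC1; exact: hc.
- by rewrite Xf; exact: hc.
- by rewrite -/(W _) Wf //; exact: hc.
Qed.

(** The base cycle translated by [u] joins u to [u qY] and [u qY qX]. A set closed under such steps
    also contains [u qX], which is [(u qY^3) qY qX], and [qX], [qY] generate. *)
Lemma realizable_even t : ~~ odd_perm t -> realizable t.
Proof.
apply: even_perm_cyc; [exact: realizable1|exact: realizableM|].
apply: (@connected_cyc _ _ realizable1 realizableM rone qY (rmul qY qX)) => //.
  exact: realizable_base.
move=> A A1 hA v; apply: (rotation_indr (P := fun r => r \in A) v A1) => {}v vA.
have step u : u \in A -> rmul u qY \in A /\ rmul u (rmul qY qX) \in A.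
  move=> uA; apply: (hA (rmul u rone)); rewrite ?(inj_eq (@rmulI u)) //; last by rewrite rmul1.
  exact/realizable_cycJ/realizable_base.
split; last by case: (step v vA).
have [] := step (rmul (rmul (rmul v qY) qY) qY).
  by do 3! (apply: (proj1 (step _ _))).
move=> _; rewrite !rmulA -(rmulA v) -(rmulA v) -(rmulA v).
by rewrite (_ : rmul (rmul (rmul qY qY) qY) qY = rone) // rmul1.
Qed.

End Family.
End Words.

(** * Color counts and even permutations *)

Definition color_code (k : color) : nat :=
  match k with red => 0 | white => 1 | green => 2 | orange => 3 | yellow => 4 | blue => 5 end.
Definition color_decode (m : nat) : color := nth red [:: red; white; green; orange; yellow; blue] m.
Lemma color_codeK : cancel color_code color_decode. Proof. by case. Qed.
HB.instance Definition _ := Equality.copy color (can_type color_codeK).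

Definition dec (P : Prop) : bool := if excluded_middle_informative P then true else false.
Lemma decP P : reflect P (dec P).
Proof. by rewrite /dec; case: excluded_middle_informative => h; constructor. Qed.

Section Enumeration.
Variables (T : finType) (rs : seq T).
Hypotheses (rs_uniq : uniq rs) (mem_rs : forall r, r \in rs).

Lemma count_inj (p : pred T) (h : T -> T) : injective h -> count (p \o h) rs = count p rs.
Proof.
move=> hI; rewrite -count_map.
suff /seq.permP -> : perm_eq (map h rs) rs by [].
apply: uniq_perm => [||r]; rewrite ?(map_inj_uniq hI) // mem_rs.
apply/mapP; exists ((perm hI)^-1%g r); first exact: mem_rs.
by rewrite -(permE hI) permKV.
Qed.

(** Equal counts give some permutation; if it is odd, composing it with the exchange of two
    positions of equal color makes it even. *)
Lemma even_perm_of_counts (X : eqType) (u v : T -> X) (x0 : X) :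
  (forall x, count (fun r => u r == x) rs = count (fun r => v r == x) rs) ->
  1 < count (fun r => u r == x0) rs ->
  exists t : {perm T}, ~~ odd_perm t /\ forall r, v r = u (t r).
Proof.
move=> hc h2.
have [r1 [r2 [ne e]]] : exists r1 r2, r1 != r2 /\ u r1 = u r2.
  move: h2; rewrite -size_filter; set s := filter _ _.
  have us : uniq s by apply: filter_uniq; exact: rs_uniq.
  have hs r : r \in s -> u r = x0 by rewrite mem_filter => /andP[/eqP].
  case: s us hs => [|r1 [|r2 s]] //= us hs _; exists r1, r2; split.
    by move: us; rewrite inE negb_or => /andP[/andP[]].
  by rewrite !hs ?inE ?eqxx ?orbT.
suff [t ht] : exists t : {perm T}, forall r, v r = u (t r).
  case odd_t: (odd_perm t); last by exists t; rewrite odd_t.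
  exists (t * tperm r1 r2)%g; split; first by rewrite odd_permM odd_t odd_tperm ne.
  by move=> r; rewrite ht permM; case: tpermP => [->|->|].
have : perm_eq (map v rs) (map u rs).
  by apply/allP => x _; rewrite inE !count_map; apply/eqP/esym/hc.
rewrite -[map u rs]/(tval (Tuple (introT eqP (size_map u rs)))).
move/tuple_permP => [p hp].
have lt r : index r rs < size rs by rewrite index_mem.
pose q r := nth r1 rs (p (Ordinal (lt r))).
have qI : injective q.
  move=> r s /eqP; rewrite nth_uniq // => /eqP /val_inj /perm_inj [e'].
  by rewrite -[r](nth_index r1 (mem_rs r)) e' nth_index.
exists (perm qI) => r; rewrite permE /q.
have <- : nth (v r1) (map v rs) (index r rs) = v r.
  by rewrite (nth_map r1) ?nth_index.
rewrite hp (nth_map (Ordinal (lt r))) ?size_enum_ord //.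
rewrite (tnth_nth (u r1)) /= (nth_map r1) //; congr (u (nth _ _ (p _))).
by apply: val_inj; rewrite /= nth_enum_ord.
Qed.

End Enumeration.

(** * Solving all clusters through one slice *)

Section Stage.
Variables (L : eqType) (en : nat -> L) (rk : L -> nat).
Hypotheses (enK : cancel en rk) (rkK : cancel rk en).
Local Notation Bar := (Bar L).
Local Notation Cell := (Cell L).
Local Notation Ldag := (Ldag L).
Local Notation config := (config L).
Implicit Types (f g : config) (c : Cell).

Let rk_inj : injective rk := can_inj rkK.
Local Notation idx := (idx rk).
Local Notation late := (late rk).
Local Notation achievable := (achievable rk).

(** The count runs over rotations, which counts cells when the orbit is free; the value 0 for NaC
    encodes legality on the cluster. *)
Definition balanced_at f c : Prop := forall v : option color,
  count (fun r => f (rotC r c) == v) rots = if v is Some _ then 4 else 0.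

Lemma count_turn f c v i (S : Bar -> bool) :
  count (fun r => f (turn i S (rotC r c)) == v) rots =
  count (fun r => f (rotC r c) == v) rots.
Proof.
pose h r := if S (coordU i (sval (rotC r c))) then rmul (rquarter i) r else r.
have hE r : turn i S (rotC r c) = rotC (h r) c.
  by rewrite /h /turn; case: ifP => //; rewrite rotC_mul.
have hI : injective h.
  suff h4 r : h (h (h (h r))) = r by apply: (can_inj (g := h \o h \o h)) => r; exact: h4.
  case e: (S (coordU i (sval (rotC r c)))); last by rewrite /h !e.
  by rewrite /h !(e, rotC_mul, coordU_quarter) -[RHS]rmul1l -(rquarter4 i) -!rmulA.
by rewrite -[RHS](count_inj uniq_rots mem_rots _ hI); apply: eq_count => r /=; rewrite hE.
Qed.

Lemma balanced_turn f c i (S : Bar -> bool) :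
  balanced_at (fun d => f (turn i S d)) c <-> balanced_at f c.
Proof. by split=> h v; have := h v; rewrite count_turn. Qed.

(** Every cluster b needs its own even permutation [pi b]. There are only finitely many
    permutations, and each is performed at once in all the clusters that need it. *)
Lemma family_solve n (a : Ldag) (D : Ldag -> Prop) f g :
  late n (Fin a) -> (forall b, D b -> late n (Fin b)) ->
  (forall b, D b -> b <> negL a) -> (a = LZero L -> forall b, D b -> ~ D (negL b)) ->
  (forall b, D b -> balanced_at f (face a b)) ->
  (forall b, D b -> balanced_at g (face a b)) ->
  exists w, [/\ achievable n w,
    forall b r, D b -> f (w (rotC r (face a b))) = g (rotC r (face a b)) &
    forall c, (forall b r, D b -> c <> rotC r (face a b)) -> w c = c].
Proof.
move=> la lD Dn D0 balf balg.
pose ok b (t : {perm rotation}) :=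
  ~~ odd_perm t /\ forall r, g (rotC r (face a b)) = f (rotC (t r) (face a b)).
pose pi b := epsilon (inhabits (1%g : {perm rotation})) (ok b).
have piP b : D b -> ok b (pi b).
  move=> Db; apply: epsilon_spec.
  apply: (@even_perm_of_counts _ _ uniq_rots mem_rots _ (fun r => f (rotC r (face a b)))
     (fun r => g (rotC r (face a b))) (Some red)).
    by move=> v; rewrite (balf _ Db) (balg _ Db).
  by rewrite (balf _ Db).
have inj := family_inj Dn D0.
(* Membership in the enumeration always holds; it is there so that the list of permutations already
   treated can grow by induction. *)
suff [w [aw w1 w2]] : exists w, [/\ achievable n w,
    forall b r, D b -> pi b \in enum {perm rotation} ->
      w (rotC r (face a b)) = rotC (pi b r) (face a b) &
    forall c, (forall b r, D b -> pi b \in enum {perm rotation} -> c <> rotC r (face a b)) ->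
      w c = c].
  exists w; split=> //; last by move=> c hc; apply: w2 => b r Db _; exact: hc.
  by move=> b r Db; rewrite w1 ?mem_enum //; have [_ ->] := piP b Db.
elim: (enum _) => [|t ts [w [aw w1 w2]]].
  by exists id; split=> //; exact: achievable_id.
case: (boolP (t \in ts)) => tts.
  have E b : (pi b \in t :: ts) = (pi b \in ts).
    by rewrite inE; case: eqP => // ->; rewrite tts.
  exists w; split=> // [b r Db|c hc]; first by rewrite E; exact: w1.
  by apply: w2 => b r Db; rewrite -E; exact: hc.
pose B b := dec (D b) && (pi b == t).
have BD b : B b -> D b by case/andP => /decP.
(* An odd [t] is never chosen as [pi b], so the previous word still serves. *)
case: (boolP (odd_perm t)) => odd_t.
  have E b : D b -> (pi b \in t :: ts) = (pi b \in ts).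
    move=> Db; rewrite inE; case: eqP => // e.
    by have [] := piP b Db; rewrite e odd_t.
  exists w; split=> // [b r Db|c hc]; first by rewrite E //; exact: w1.
  by apply: w2 => b r Db; rewrite -E //; exact: hc.
have [v [av [v1 v2]]] := realizable_even la lD Dn D0 odd_t BD.
exists (v \o w); split; first exact: achievable_comp.
- move=> b r Db; rewrite inE /=; case: (eqVneq (pi b) t) => [e _|ne /= h].
    rewrite w2; first by rewrite v1 ?e // /B e eqxx andbT; apply/decP.
    move=> b' r' Db' h /(inj _ _ _ _ Db Db') [e' _]; subst b'; by rewrite e (negbTE tts) in h.
  rewrite w1 // v2 // => b' r' Bb' /(inj _ _ _ _ Db (BD _ Bb')) [e' _]; subst b'.
  by case/andP: Bb' => _ /eqP h'; rewrite h' eqxx in ne.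
- move=> c hc /=; rewrite w2; last first.
    by move=> b r Db h; apply: hc => //; rewrite inE h orbT.
  apply: v2 => b r Bb; apply: hc; first exact: BD.
  by case/andP: Bb => _ /eqP ->; rewrite inE eqxx.
Qed.

Definition low n c : bool :=
  let: (x, y, z) := sval c in ~~ [&& late n x, late n y & late n z].

Lemma low_rot n r c : low n (rotC r c) = low n c.
Proof.
case: c => [[[x y] z] h]; rewrite /low /=.
by case: r => [[[[]|] []] [[] []]] /=; rewrite ?late_neg; congr (~~ _);
  case: (late n x); case: (late n y); case: (late n z).
Qed.

Definition agree n f g : Prop := forall c, is_center (sval c) || low n c -> f c = g c.

(** The clusters new at level n are represented by a face cell with coordinates [pivot n] and a
    partner. The partner -pivot is left out because it gives the cluster of the pivot paired with
    itself; at level 0, b and -b give the same cluster and only positive partners are kept. *)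
Definition pivot (n : nat) : Ldag := if n is m.+1 then LPos (en m) else LZero L.
Definition partner (n : nat) (b : Ldag) : Prop :=
  if n is _.+1 then n < idx b \/ b = pivot n else exists l, b = LPos l.

Lemma idx_pivot n : idx (pivot n) = n.
Proof. by case: n => //= n; rewrite enK. Qed.

Lemma partner_neg n b : partner n b -> b <> negL (pivot n).
Proof.
case: n => [[l ->] //|n [h e|-> //]].
by move: h; rewrite e idx_neg idx_pivot ltnn.
Qed.

Lemma partner_zero n : pivot n = LZero L -> forall b, partner n b -> ~ partner n (negL b).
Proof. by case: n => // _ b [l ->] [l']. Qed.

Lemma partner_late n b : partner n b -> late n (Fin b).
Proof. by case: n => //= n [/ltnW //|->]; rewrite /= enK. Qed.

Lemma partner_cases n v : n <= idx v ->
  [\/ partner n v, negL (pivot n) = pivot n /\ partner n (negL v) | v = negL (pivot n)].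
Proof.
case: n => [|n]; first by case: v => [l||l] _; [constructor 2; split; last exists l|
  constructor 3|constructor 1; exists l].
rewrite leq_eqVlt => /orP[/eqP e|h]; last by constructor 1; left.
have : idx v = idx (pivot n.+1) by rewrite idx_pivot.
by move/(idx_eq rk_inj) => [->|->]; [constructor 1; right|constructor 3].
Qed.

Lemma faceX (a b : Ldag) : rotC (rquarter AX) (face a b) = face (negL b) a.
Proof. exact: cell_inj. Qed.

(** Quarter and half turns about the x axis put a coordinate of index n first and make it equal to
    [pivot n]; [partner_cases] then settles the other coordinate. *)
Lemma family_cover n c : ~~ is_center (sval c) -> ~~ low n c -> low n.+1 c ->
  exists b r, partner n b /\ c = rotC r (face (pivot n) b).
Proof.
pose fam c := exists b r, partner n b /\ c = rotC r (face (pivot n) b).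
have famV r c' : fam (rotC r c') -> fam c'.
  move=> [b [s [pb e]]]; exists b, (rmul (rinv r) s); split=> //.
  by rewrite rotC_mul -e rotCK.
rewrite -/(fam c); have [r [u [v ->]]] := face_cell c.
rewrite !low_rot is_center_rot => nc hl hl'.
apply: (famV (rinv r)); rewrite rotCK.
have {hl} [lu lv] : n <= idx u /\ n <= idx v by move: hl; rewrite /low /= negbK => /andP.
have {hl'} : idx u = n \/ idx v = n.
  move: hl'; rewrite /low /= negb_and -!ltnNge !ltnS => /orP[h|h]; [left|right];
  by apply/eqP; rewrite eqn_leq h.
wlog e : u v nc lu lv / idx u = n.
  move=> H [e|e]; first by apply: H => //; left.
  apply: (famV (rquarter AX)); rewrite faceX; apply: H; rewrite ?idx_neg //; last by left.
  by rewrite -faceX is_center_rot.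
move=> _.
have qXX (a b : Ldag) : rotC (rmul (rquarter AX) (rquarter AX)) (face a b) = face (negL a) (negL b).
  by rewrite rotC_mul !faceX.
wlog {e} e : u v nc lu lv / u = pivot n.
  move=> H; have := e; rewrite -{1}(idx_pivot n) => /(idx_eq rk_inj) [] h; first exact: H.
  apply: (famV (rmul (rquarter AX) (rquarter AX))); rewrite qXX.
  by apply: H; rewrite ?idx_neg // -?qXX ?is_center_rot // h negLK.
subst u; have fp b : partner n b -> fam (face (pivot n) b).
  by exists b, rone; split=> //; rewrite rotC1.
have [pv|[p0 pv]|ev] := partner_cases lv.
- exact: fp.
- apply: (famV (rmul (rquarter AX) (rquarter AX))); rewrite qXX p0; exact: fp.
- case: (eqVneq n 0) => [n0|n0].
    by case/negP: nc; apply/is_center_face; rewrite ev n0.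
  apply: (famV (rquarter AX)); rewrite faceX ev negLK; apply: fp.
  by case: (n) n0 => // m _; right.
Qed.

(** The word moves only the clusters represented at level n; by [family_cover] every other cell
    concerned already agrees. *)
Lemma stage n f g :
  (forall c, ~~ is_center (sval c) -> balanced_at f c) ->
  (forall c, ~~ is_center (sval c) -> balanced_at g c) ->
  agree n f g -> exists w, achievable n w /\ agree n.+1 (fun c => f (w c)) g.
Proof.
move=> bf bg fg.
have nc b : partner n b -> ~~ is_center (sval (face (pivot n) b)).
  move=> pb; apply/negP => /is_center_face [h1 h2].
  by apply: (partner_neg pb); rewrite h1 h2.
have lp : late n (Fin (pivot n)) by rewrite /= idx_pivot.
have [w [aw w1 w2]] := family_solve lp (@partner_late n) (@partner_neg n) (@partner_zero n)
  (fun b pb => bf _ (nc b pb)) (fun b pb => bg _ (nc b pb)).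
exists w; split=> // c hc.
case: (classic (exists b r, partner n b /\ c = rotC r (face (pivot n) b))).
  by move=> [b [r [pb ->]]]; exact: w1.
move=> no; rewrite w2; last by move=> b r pb e; apply: no; exists b, r.
apply: fg; apply: contra_notT no; rewrite negb_or => /andP[n1 n2].
by apply: family_cover => //; move: hc; rewrite (negbTE n1).
Qed.

(** A center cell outside the middle slice lies on the axis of rotation and is fixed by it. *)
Lemma turn0_center i c : is_center (sval c) ->
  turn i (fun be => bar_eqb be (Fin (LZero L))) c = rotC (rquarter i) c.
Proof.
move=> h; rewrite /turn; case: bar_eqbP => // ne; apply: cell_inj.
case: c h ne => [[[x y] z] h] /=.
by case: i; case: x h => [[?||?]||] //; case: y => [[?||?]||] //; case: z => [[?||?]||].
Qed.

Definition center_at (r : rotation) f : Prop :=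
  forall c, is_center (sval c) -> f c = solvedU (rotate (@negB L) r (sval c)).

Lemma center_turn r f i : center_at r f ->
  center_at (rmul r (rquarter i))
    (fun c => f (turn i (fun be => bar_eqb be (Fin (LZero L))) c)).
Proof.
move=> h c hc; rewrite turn0_center // h ?is_center_rot //.
by rewrite (rotate_mul (@negBK L)).
Qed.

(** Middle slices move the centers like rotations of the whole cube, and no cell is low at level
    0. *)
Lemma center_stage r s f g : center_at r f -> center_at s g ->
  exists w, achievable 0 w /\ agree 0 (fun c => f (w c)) g.
Proof.
move=> hf hg.
suff [w [aw h]] : exists w, achievable 0 w /\ center_at s (fun c => f (w c)).
  exists w; split=> // c /orP[hc|]; first by rewrite h // hg.
  by rewrite /low; case: c => [[[[x||] [y||]] [z||]] hz].
apply: (rotation_indr (P := fun s => exists w, achievable 0 w /\ center_at s (fun c => f (w c))) s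
   (r := r)).
  by exists id; split; first exact: achievable_id.
have step t i : (exists w, achievable 0 w /\ center_at t (fun c => f (w c))) ->
    exists w, achievable 0 w /\ center_at (rmul t (rquarter i)) (fun c => f (w c)).
  move=> [w [aw h]]; exists (w \o turn i (fun be => bar_eqb be (Fin (LZero L)))); split.
    by apply: achievable_comp => //; apply: achievable_turn => be /bar_eqbP ->.
  exact: (@center_turn t (fun c => f (w c)) i h).
by move=> t ht; split; exact: step.
Qed.

End Stage.

Lemma In_map (A : eqType) (B : Type) (h : A -> B) (s : seq A) y :
  List.In y (map h s) <-> exists2 x, x \in s & y = h x.
Proof.
elim: s => [|a s IH] /=; first by split=> // -[].
rewrite IH; split=> [[<-|[x xs ->]]|[x]].
- by exists a; rewrite ?mem_head.
- by exists x; rewrite // inE xs orbT.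
- by rewrite inE => /orP[/eqP ->|xs ->]; [left|right; exists x].
Qed.

Lemma NoDup_map_inj (A : eqType) (B : Type) (h : A -> B) (s : seq A) :
  injective h -> uniq s -> List.NoDup (map h s).
Proof.
move=> hI; elim: s => [|a s IH] /=; first by constructor.
case/andP => na us; constructor; last exact: IH.
by move/In_map => [x xs /hI e]; rewrite e xs in na.
Qed.

(** * Invariants of legal accessibility *)

Section StandardConfigurations.
Variable L : eqType.
Local Notation Bar := (Bar L).
Local Notation Cell := (Cell L).
Local Notation config := (config L).
Implicit Types (f g : config) (c : Cell).

Definition slice (al : Bar) : Bar -> bool := fun be => bar_eqb be al.

Lemma actE (s : btwist L) f c :
  act s f c = f (iter (3 - bk s) (turn (bax s) (slice (bal s))) c).
Proof. rewrite /act; congr f; apply: eq_iter => d. exact: twistCE. Qed.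

Lemma act_iter (s : btwist L) f c :
  act s f (iter (bk s).+1 (turn (bax s) (slice (bal s))) c) = f c.
Proof.
rewrite actE -iterD; case: s => i al k /=.
have -> : 3 - k + k.+1 = 4 by rewrite addnS subnK // ltnW.
by rewrite /= turn4.
Qed.

Lemma balanced_ext f g c :
  (forall r, f (rotC r c) = g (rotC r c)) -> balanced_at f c -> balanced_at g c.
Proof. by move=> e h v; rewrite -(h v); apply: eq_count => r; rewrite e. Qed.

Lemma balanced_iter f c k i S :
  balanced_at (fun d => f (iter k (turn i S) d)) c <-> balanced_at f c.
Proof.
elim: k f => [|k IH] f //=.
by rewrite (IH (fun d => f (turn i S d))) balanced_turn.
Qed.

Lemma balanced_act s f c : balanced_at (act s f) c <-> balanced_at f c.
Proof.
rewrite -(balanced_iter f c (3 - bk s) (bax s) (slice (bal s))).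
by split; apply: balanced_ext => r; rewrite actE.
Qed.

Definition centered f : Prop := exists r, center_at r f.

Lemma centerP c : is_center (sval c) -> exists r, c = rotC r (face (LZero L) (LZero L)).
Proof.
have [r [a [b ->]]] := face_cell c.
by rewrite is_center_rot => /is_center_face [-> ->]; exists r.
Qed.

Lemma centered_ext f g :
  (forall r, f (rotC r (face (LZero L) (LZero L))) = g (rotC r (face (LZero L) (LZero L)))) ->
  centered f -> centered g.
Proof. by move=> e [r h]; exists r => c hc; rewrite -h //; have [s ->] := centerP hc. Qed.

Lemma turn_center i al c : is_center (sval c) -> al <> Fin (LZero L) ->
  turn i (slice al) c = c.
Proof.
move=> h hal; rewrite /turn /slice; case: bar_eqbP => // e; apply: cell_inj.
case: c h e hal => [[[x y] z] h] /=.
by case: i => h0 <-; case: x h h0 => [[?||?]||] //; case: y => [[?||?]||] //;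
  case: z => [[?||?]||].
Qed.

Lemma centered_iter f k i al : centered f ->
  centered (fun c => f (iter k (turn i (slice al)) c)).
Proof.
elim: k f => [|k IH] f //= [r h].
apply: (IH (fun c => f (turn i (slice al) c))).
case: (bar_eqbP al (Fin (LZero L))) => [->|ne].
  by exists (rmul r (rquarter i)); exact: center_turn.
by exists r => c hc; rewrite turn_center // h.
Qed.

Lemma centered_act s f : centered (act s f) <-> centered f.
Proof.
split=> h.
  have := centered_iter (bk s).+1 (bax s) (bal s) h.
  by apply: centered_ext => r; rewrite act_iter.
have := centered_iter (3 - bk s) (bax s) (bal s) h.
by apply: centered_ext => r; rewrite actE.
Qed.

(** By freeness, the 24 rotations enumerate the cluster without repetition. *)
Lemma exactly_count f c k n : ~~ is_center (sval c) ->
  exactly n (fun d => cluster c d /\ f d = Some k) <->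
  count (fun r => f (rotC r c) == Some k) rots = n.
Proof.
move=> nc; pose l := [seq rotC r c | r <- rots & f (rotC r c) == Some k].
have Nl : List.NoDup l.
  by apply: NoDup_map_inj; [exact: rotC_inj|apply: filter_uniq; exact: uniq_rots].
have Il d : List.In d l <-> cluster c d /\ f d = Some k.
  split=> [/In_map [r]|[/clusterP [r ->] e]].
    rewrite mem_filter => /andP[/eqP e _] ->; split=> //.
    by apply/clusterP; exists r.
  by apply/In_map; exists r => //; rewrite mem_filter e eqxx mem_rots.
have Sl : List.length l = count (fun r => f (rotC r c) == Some k) rots.
  by rewrite -size_filter -(size_map (fun r => rotC r c)).
split=> [[s [Ns [<- Is]]]|<-]; last by exists l.
rewrite -Sl; apply: Permutation.Permutation_length; apply: Permutation.NoDup_Permutation => //.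
by move=> d; rewrite Il Is.
Qed.

(** The coordinate permutation underlying a rotation; its parity is [sw]. *)
Definition perm3 (n : option bool) (sw : bool) : 'S_3 :=
  match n, sw with
  | None, false => 1
  | Some false, false => cyc o0 o1 o2
  | Some true, false => cyc o0 o2 o1
  | None, true => tperm o0 o1
  | Some false, true => tperm o0 o2
  | Some true, true => tperm o1 o2
  end%g.

Lemma ord3P (i : 'I_3) : [\/ i = o0, i = o1 | i = o2].
Proof.
case: i => [[|[|[|//]]] h]; [constructor 1|constructor 2|constructor 3]; exact: val_inj.
Qed.

Lemma odd_perm3 n sw : odd_perm (perm3 n sw) = sw.
Proof. by case: n => [[]|]; case: sw; rewrite /= ?odd_perm1 ?odd_permM ?odd_tperm. Qed.

Lemma perm3E n sw : (perm3 n sw o0, perm3 n sw o1, perm3 n sw o2) =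
  match n, sw with
  | None, false => (o0, o1, o2)
  | Some false, false => (o1, o2, o0)
  | Some true, false => (o2, o0, o1)
  | None, true => (o1, o0, o2)
  | Some false, true => (o2, o1, o0)
  | Some true, true => (o0, o2, o1)
  end.
Proof.
case: n => [[]|]; case: sw; rewrite /perm3 ?tpermL ?tpermR ?perm1 ?tpermD //.
- by have [-> -> ->] := @cycE _ o0 o2 o1 isT isT isT.
- by have [-> -> ->] := @cycE _ o0 o1 o2 isT isT isT.
Qed.

Lemma perm3P (sg : 'S_3) : exists n sw, sg = perm3 n sw.
Proof.
suff [n [sw e]] : exists n sw, (sg o0, sg o1, sg o2) =
    (perm3 n sw o0, perm3 n sw o1, perm3 n sw o2).
  exists n, sw; apply/permP => i; case: e => e0 e1 e2.
  by case: (ord3P i) => ->.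
have n01 : sg o0 <> sg o1 by move/perm_inj.
have n02 : sg o0 <> sg o2 by move/perm_inj.
have n12 : sg o1 <> sg o2 by move/perm_inj.
case: (ord3P (sg o0)) (ord3P (sg o1)) (ord3P (sg o2)) n01 n02 n12 =>
  -> [] -> [] -> //= _ _ _;
 [exists None, false|exists (Some true), true|exists None, true
 |exists (Some false), false|exists (Some true), false|exists (Some false), true];
 by rewrite perm3E.
Qed.

Lemma rotU_perm3 n sw (eps : 'I_3 -> bool) (p : U L) : det_one (perm3 n sw) eps ->
  rotU (perm3 n sw) eps p = rotate (@negB L) (n, sw, (eps o0, eps o1)) p.
Proof.
have := perm3E n sw; rewrite /det_one /rotU odd_perm3 => e.
case: p => [[x y] z] h; have -> : eps o2 = eps o0 (+) eps o1 (+) sw.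
  by move: h; case: (sw); case: (eps o0); case: (eps o1); case: (eps o2).
by case: n sw e {h} => [[]|] [] [-> -> ->]; rewrite /= /sgnB /signed.
Qed.

Lemma centeredP f :
  (exists (sg : 'S_3) (eps : 'I_3 -> bool), det_one sg eps /\
     forall c, is_center (sval c) -> f c = solvedU (rotU sg eps (sval c))) <-> centered f.
Proof.
split=> [[sg [eps [d h]]]|[[[n sw] [e0 e1]] h]].
  have [n [sw e]] := perm3P sg; subst sg.
  by exists (n, sw, (eps o0, eps o1)) => c hc; rewrite h // rotU_perm3.
pose eps (i : 'I_3) := nth false [:: e0; e1; e0 (+) e1 (+) sw] i.
have d : det_one (perm3 n sw) eps.
  by rewrite /det_one odd_perm3 /eps /=; case: (sw); case: (e0); case: (e1).
by exists (perm3 n sw), eps; split=> // c hc; rewrite rotU_perm3 // h.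
Qed.

Lemma standardP f : standard f <->
  [/\ legal f, forall c, ~~ is_center (sval c) -> balanced_at f c & centered f].
Proof.
split=> [[lf [hc /centeredP hz]]|[lf hb /centeredP hz]]; split=> //.
  move=> c nc [k|]; first by apply/(exactly_count _ _ _ nc); exact: hc.
  by apply/eqP; rewrite -leqn0 leqNgt -has_count; apply/hasPn => r _; apply/eqP/lf.
by split=> // c nc k; apply/(exactly_count _ _ _ nc); exact: (hb c nc (Some k)).
Qed.

Lemma standard_solved : standard (@f_solved L).
Proof.
apply/standardP; split.
- by move=> [[[[x||] [y||]] [z||]] h].
- move=> c nc v; have [s [a [b ->]]] := face_cell c.
  have sI := @rmulIr s.
  (* Translating the labels by [s] reduces to a face cell, where the count is a computation
     independent of a and b. *)
  have -> : count (fun r => f_solved (rotC r (rotC s (face a b))) == v) rots =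
            count (fun r => f_solved (rotC r (face a b)) == v) rots.
    rewrite -[RHS](count_inj uniq_rots mem_rots _ sI).
    by apply: eq_count => r /=; rewrite -rotC_mul.
  by case: v => [[]|].
- by exists rone => c _; case: c => [[[x y] z] h].
Qed.

End StandardConfigurations.

(** * Transfinite runs restricted to one cluster *)

Section Runs.
Variables (L : eqType) (I : wellorder) (s : I -> btwist L).
Variables (f0 : config L) (F : option I -> config L).
Hypothesis run : is_run s f0 F.

Lemma slt_wf : well_founded (@slt I).
Proof.
have A x : Acc (@slt I) (Some x).
  elim: (@wlt_wf I x) => {}x _ IH; constructor; case=> [y yx|[]]; exact: (IH y yx).
case=> [x|]; first exact: A.
by constructor; case=> [y _|[]]; exact: A.
Qed.

Lemma slt_trans (a b c : option I) : slt a b -> slt b c -> slt a c.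
Proof. case: a b c => [x|] [y|] [z|] //=; exact: wlt_trans. Qed.

Lemma sle_total (a b : option I) : sle a b \/ sle b a.
Proof.
case: a b => [x|] [y|]; rewrite /sle /=; try tauto.
by case: (wlt_tot x y) => [|[->|]]; tauto.
Qed.

Lemma sle_trans (a b c : option I) : sle a b -> sle b c -> sle a c.
Proof. by case=> [ab|->] // [bc|<-]; left=> //; exact: slt_trans bc. Qed.

(* On a finite family of cells that is closed under twists, every value that
   survives to a limit stage is attained simultaneously before that stage, and
   the value NaC is never lost. *)
Lemma run_invariant c (P : config L -> Prop) :
  (forall f g, (forall r, f (rotC r c) = g (rotC r c)) -> P f -> P g) ->
  (forall t f, P f -> P (act t f)) -> P f0 ->
  forall eta, (exists r, F eta (rotC r c) = None) \/ P (F eta).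
Proof.
move=> Ploc Pact P0; move=> eta; elim: (slt_wf eta) => {}eta _ IH.
have [r1 [r2 r3]] := run eta.
case: (classic (forall b, ~ slt b eta)) => [/r1 e|/not_all_not_ex ex].
  by right; apply: Ploc P0 => r; rewrite e.
case: (classic (exists j, slt (Some j) eta /\ forall b, ~ (slt (Some j) b /\ slt b eta))).
  move=> [j [h1 h2]]; have e := r2 j h1 h2.
  case: (IH _ h1) => [[r hr]|hP]; [left|right].
    (* The twist carries the NaC cell to another cell of the same cluster. *)
    have E k : exists r', iter k (turn (bax (s j)) (slice (bal (s j)))) (rotC r c) = rotC r' c.
      elim: k => [|k [r' IHk]]; first by exists r.
      rewrite /= IHk; case: (turn_rot (bax (s j)) (slice (bal (s j))) (rotC r' c)) => t ->.
      by exists (rmul t r'); rewrite rotC_mul.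
    have [r' er] := E (bk (s j)).+1; exists r'.
    by rewrite e -er act_iter.
  by apply: Ploc (Pact (s j) _ hP) => r; rewrite e.
move=> nosucc; have {r3} lim := r3 ex.
case: (classic (exists r, F eta (rotC r c) = None)) => [|nn]; [by left|right].
have ev r : eventually_const F eta (rotC r c) (F eta (rotC r c)).
  have [|l1 l2] := lim _ (rotC r c).
    move=> j hj; apply: NNPP => no; apply: nosucc; exists j; split=> // b hb.
    by apply: no; exists b.
  apply: NNPP => no; apply: nn; exists r; apply: l2 => v hv.
  by apply: no; rewrite (l1 _ hv).
(* The 24 cells of the orbit have thresholds below [eta], and finitely many of these have a
   maximum. *)
have [b [hb bP]] : exists b, slt b eta /\ forall r, r \in rots -> forall g, sle b g ->
    slt g eta -> F g (rotC r c) = F eta (rotC r c).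
  elim: rots => [|r l [b [hb IHl]]]; first by case: ex => b hb; exists b.
  have [b' [hb' h']] := ev r.
  have [b'' [hb'' [le1 le2]]] : exists b'', slt b'' eta /\ sle b b'' /\ sle b' b''.
    by case: (sle_total b b') => h; [exists b'|exists b]; split=> //; split=> //; right.
  exists b''; split=> // r'; rewrite inE => /orP[/eqP ->|r'l] g hg.
    by apply: h'; exact: sle_trans hg.
  by apply: IHl => //; exact: sle_trans hg.
have {}bP r : F b (rotC r c) = F eta (rotC r c).
  by apply: bP => //; [exact: mem_rots|right].
case: (IH _ hb) => [[r hr]|]; last exact: Ploc.
by case: nn; exists r; rewrite -bP.
Qed.

End Runs.

Lemma accessible_invariant (L : eqType) (f g : config L) c (P : config L -> Prop) :
  accessible f g -> legal g ->
  (forall f g, (forall r, f (rotC r c) = g (rotC r c)) -> P f -> P g) ->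
  (forall t f, P f -> P (act t f)) -> P f -> P g.
Proof.
move=> [I [s [F [run e]]]] lg Ploc Pact Pf.
case: (run_invariant run Ploc Pact Pf None) => [[r]|].
  by rewrite e => /lg.
by apply: Ploc => r; rewrite e.
Qed.

(** Balance and centering are equivalent before and after a twist, so the invariance applies to each
    property and to its negation; the latter gives the converse. *)
Lemma accessible_standard (L : eqType) (f g : config L) :
  accessible f g -> legal f -> legal g -> (standard f <-> standard g).
Proof.
move=> fg lf lg; have inv c P := @accessible_invariant L f g c P fg lg.
have eqv c P : (forall f g, (forall r, f (rotC r c) = g (rotC r c)) -> P f -> P g) ->
    (forall t f, P (act t f) <-> P f) -> (P f <-> P g).
  move=> Ploc Pact; split; first by apply: (inv c P) => // t h hP; apply/Pact.
  move=> Pg; apply: NNPP => nPf; suff : ~ P g by [].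
  apply: (inv c (fun h => ~ P h)) nPf.
    by move=> h h' e nh h'P; apply: nh; apply: Ploc h'P => r; rewrite e.
  by move=> t h nh hP; apply: nh; case: (Pact t h) => + _; exact.
have hb c : balanced_at f c <-> balanced_at g c.
  apply: (eqv c (fun h => balanced_at h c)); first by move=> h h'; exact: balanced_ext.
  by move=> t h; exact: balanced_act.
have hc : centered f <-> centered g.
  apply: (eqv (face (LZero L) (LZero L))); first by move=> h h'; exact: centered_ext.
  by move=> t h; exact: centered_act.
split=> /standardP [_ b z]; apply/standardP; split=> //; try exact/hc;
  by move=> c nc; apply/hb/b.
Qed.

(** * The sequence of length omega^2 *)

Lemma lexlt_wf : well_founded lexlt.
Proof.
case=> n; elim/ltn_ind: n => n IHn k; elim/ltn_ind: k => k IHk.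
constructor; case=> n' k' []; rewrite /=; first by move=> h; exact: IHn.
by case=> -> h; exact: IHk.
Qed.

Definition omega2 : wellorder.
Proof.
apply: (@WO (nat * nat)%type lexlt _ _ _ lexlt_wf).
- by case=> a b; rewrite /lexlt /= !ltnn => -[|[]].
- case=> [a1 a2] [b1 b2] [c1 c2]; rewrite /lexlt /=.
  by move=> [h|[-> h]] [h'|[<- h']]; [left; exact: ltn_trans h'|left|left|right;
    split=> //; exact: ltn_trans h'].
- case=> [a1 a2] [b1 b2]; rewrite /lexlt /=.
  case: (ltngtP a1 b1) => [h|h|->]; [by left; left|by right; right; left|].
  case: (ltngtP a2 b2) => [h|h|->]; [by left; right|by right; right; right|].
  by right; left.
Defined.

Section OmegaSquare.
Variables (L : eqType) (en : nat -> L) (rk : L -> nat).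
Hypotheses (enK : cancel en rk) (rkK : cancel rk en).
Local Notation Bar := (Bar L).
Local Notation Cell := (Cell L).
Local Notation Ldag := (Ldag L).
Local Notation config := (config L).
Local Notation turn_block := (axis * (Bar -> bool))%type.
Local Notation idx := (idx rk).
Local Notation late := (late rk).
Local Notation valid := (valid rk).

(** Positive and negative elements alternate by increasing index, so the elements of index at least
    n form a final segment, from rank 2n - 1 on (from 0 on if n = 0). *)
Definition rank (a : Ldag) : nat :=
  match a with LZero => 0 | LPos l => (rk l).*2.+1 | LNeg l => (rk l).*2.+2 end.
Definition unrank (j : nat) : Ldag :=
  if j is j'.+1 then if odd j' then LNeg (en j'./2) else LPos (en j'./2) else LZero L.

Lemma unrankK : cancel unrank rank.
Proof.
case=> [//|j] /=; have := odd_double_half j.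
by case: (odd j) => /=; rewrite enK; lia.
Qed.

Lemma rankK : cancel rank unrank.
Proof.
case=> [l||l] //=; first by rewrite odd_double /= uphalf_double rkK.
by rewrite odd_double doubleK rkK.
Qed.

Lemma late_rank n a : late n (Fin a) = (n.*2.-1 <= rank a).
Proof. by case: a => [l||l]; case: n => [|n] //=; lia. Qed.

Definition slices (n k : nat) : Bar :=
  match k with
  | 0 => PInf L
  | 1 => NInf L
  | k'.+2 => Fin (unrank (k' + n.*2.-1))
  end.

Lemma slices_late n k : late n (slices n k).
Proof. by case: k => [|[|k]] //; rewrite late_rank unrankK leq_addl. Qed.

Lemma slices_inj n : injective (slices n).
Proof.
move=> [|[|j]] [|[|k]] //= [] /(can_inj unrankK) /eqP.
by rewrite eqn_add2r => /eqP ->.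
Qed.

Lemma slices_surj n be : late n be -> exists k, slices n k = be.
Proof.
case: be => [a||]; [|by exists 0|by exists 1].
rewrite late_rank => h; exists (rank a - n.*2.-1).+2.
by rewrite /= subnK // rankK.
Qed.

(* Every slice used at level [n] receives two basic twists, with net effect the
   quarter turn [T^2 T^3] if it is selected and the identity [T T^3] otherwise. *)
Definition block_twist (n : nat) (u : turn_block) (k : nat) : btwist L :=
  let al := slices n k./2 in
  if odd k then BT u.1 al o0 else BT u.1 al (if u.2 al then o1 else o2).

Fixpoint block_config (n : nat) (u : turn_block) (h : config) (k : nat) : config :=
  if k is k'.+1 then act (block_twist n u k') (block_config n u h k') else h.

Lemma block_config_double n u h k c :
  block_config n u h k.*2 c =
  h (turn u.1 (fun be => u.2 be && has (fun j => bar_eqb be (slices n j)) (iota 0 k)) c).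
Proof.
case: u => i S; elim: k c => [|k IH] c.
  by rewrite /turn /= andbF.
have t1 : block_twist n (i, S) k.*2.+1 = BT i (slices n k) o0.
  by rewrite /block_twist /= odd_double (_ : uphalf k.*2 = k) // uphalf_double.
have t0 : block_twist n (i, S) k.*2 = BT i (slices n k) (if S (slices n k) then o1 else o2).
  by rewrite /block_twist odd_double doubleK.
rewrite doubleS [block_config _ _ _ _]/= actE t1 actE t0.
set al := slices n k; rewrite [bk _]/= [bax _]/= [bal _]/=.
(* On cells, [o1], [o2] and [o0] contribute the inverse exponents 2, 1 and 3; the totals are 5, a
   quarter turn, and 4, the identity. *)
have -> : iter (3 - (if S al then o1 else o2)) (turn i (slice al)) (iter 3 (turn i (slice al)) c)
   = turn i (fun be => S be && bar_eqb be al) c.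
  rewrite -iterD iter_turn /turn /slice.
  case: bar_eqbP => [->|_]; last by rewrite andbF.
  have q4 d : iter 4 (rotC (rquarter i)) d = d by rewrite /= -!rotC_mul -!rmulA rquarter4 rotC1.
  rewrite andbT; case: (S al); last exact: q4.
  by rewrite -[3 - o1 + 3]/5 iterSr q4.
rewrite IH; congr h.
have hasS y : has (fun j => bar_eqb y (slices n j)) (iota 0 k.+1) =
    has (fun j => bar_eqb y (slices n j)) (iota 0 k) || bar_eqb y al.
  by rewrite -addn1 iotaD has_cat /= orbF.
have nh : has (fun j => bar_eqb al (slices n j)) (iota 0 k) = false.
  apply/hasPn => j; rewrite mem_iota /= => jk; apply/bar_eqbP => /slices_inj e'.
  by rewrite e' ltnn in jk.
rewrite /turn [(i, S).1]/= [(i, S).2]/=; cbv beta; rewrite !hasS.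
set x := coordU i (sval c).
case: (bar_eqbP x al) => [e|_]; last by rewrite andbF orbF -/x.
rewrite orbT andbT e; case: (S al); last by rewrite -/x e nh andbF.
by rewrite coordU_quarter -/x e nh andbF.
Qed.

Lemma block_config_fix n u h k c : coordU u.1 (sval c) <> slices n k./2 ->
  block_config n u h k.+1 c = block_config n u h k c.
Proof.
move=> ne; rewrite /= actE iter_turn /block_twist /slice.
by case: (odd k) => /=; case: bar_eqbP.
Qed.

(** A cell lies on one slice along the axis, treated at positions 2j and 2j + 1 only, so its color
    is constant afterwards; a cell on no late slice never moves. *)
Lemma block_limit n u h c : valid n u ->
  exists K, forall k, K <= k -> block_config n u h k c = h (turn u.1 u.2 c).
Proof.
move=> vu.
suff [K [fix_ eK]] : exists K, (forall k, K <= k -> coordU u.1 (sval c) <> slices n k./2) /\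
    block_config n u h K c = h (turn u.1 u.2 c).
  exists K => k; elim: k => [|k IH]; first by rewrite leqn0 => /eqP <-.
  rewrite leq_eqVlt => /orP[/eqP <- //|lt].
  by rewrite block_config_fix ?IH //; exact: fix_.
case l: (late n (coordU u.1 (sval c))); last first.
  exists 0; split=> [k _ e|/=]; first by rewrite e slices_late in l.
  by rewrite /turn; case: ifP => // /vu; rewrite l.
have [j ej] := slices_surj l; exists j.+1.*2; split.
  move=> k jk; rewrite -ej => /slices_inj e.
  by lia.
rewrite block_config_double /turn -ej; congr h.
suff -> : has (fun j' => bar_eqb (slices n j) (slices n j')) (iota 0 j.+1) by rewrite andbT.
by apply/hasP; exists j; rewrite ?mem_iota ?leqnn //; apply/bar_eqbP.
Qed.

Variables f g : config.
Hypotheses (f_std : standard f) (g_std : standard_face g).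

Definition balanced (h : config) : Prop :=
  forall c, ~~ is_center (sval c) -> balanced_at h c.

Let bal_f : balanced f. Proof. by case/standardP: f_std. Qed.
Let bal_g : balanced g. Proof. by case: g_std => /standardP []. Qed.

Definition good_word (n : nat) (h : config) (l : seq turn_block) : Prop :=
  List.Forall (valid n) l /\ agree rk n.+1 (fun c => h (wmap l c)) g.

Lemma good_word_ex n h : balanced h -> agree rk n h g -> exists l, good_word n h l.
Proof.
move=> bh ah; have [w [[l [vl e]] aw]] := stage enK rkK bh bal_g ah.
by exists l; split=> // c hc; rewrite -aw // e.
Qed.

Lemma balanced_wmap h l : balanced h -> balanced (fun c => h (wmap l c)).
Proof.
elim: l h => [|u l IH] h bh //=; apply: (IH (fun c => h (turn u.1 u.2 c))) => c nc.
by apply/balanced_turn/bh.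
Qed.

(** Level 0 first brings the centers into place and then treats its clusters. *)
Lemma good_word_init : exists l, good_word 0 f l.
Proof.
have [r hr] : centered f by case/standardP: f_std.
have [s hs] : centered g by case: g_std => /standardP [].
have [w [[l1 [v1 e1]] a1]] := center_stage rk hr hs.
have [l2 [v2 a2]] : exists l, good_word 0 (fun c => f (wmap l1 c)) l.
  apply: good_word_ex; first exact: balanced_wmap.
  by move=> c hc; rewrite -a1 // e1.
exists (l1 ++ l2); split; first by apply/List.Forall_app.
by move=> c hc; rewrite wmap_cat a2.
Qed.

Definition word (n : nat) (h : config) : seq turn_block :=
  epsilon (inhabits [::]) (good_word n h).
Definition word0 : seq turn_block := epsilon (inhabits [::]) (good_word 0 f).

(* A state consists of a level, the current configuration and the blocks still to
   be applied at that level; a level ends with an idle block. *)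
Definition state : Type := (nat * config * seq turn_block)%type.
Definition level (x : state) : nat := x.1.1.
Definition current (x : state) : config := x.1.2.
Definition block (x : state) : turn_block := head (AX, fun _ => false) x.2.
Definition next (x : state) : state :=
  match x with
  | (n, h, [::]) => (n.+1, h, word n.+1 h)
  | (n, h, u :: l) => (n, fun c => h (turn u.1 u.2 c), l)
  end.
Definition state_at (k : nat) : state := iter k next (0, f, word0).

Lemma state_inv k : balanced (current (state_at k)) /\
  good_word (level (state_at k)) (current (state_at k)) (state_at k).2.
Proof.
elim: k => [|k]; first by split=> //; apply: epsilon_spec; exact: good_word_init.
rewrite /state_at iterS -/(state_at k); case: (state_at k) => [[n h] [|u l]] [bh [vl al]] /=.
  by split=> //; apply: epsilon_spec; exact: good_word_ex.
split; first exact: (@balanced_wmap h [:: u]).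
by inversion vl; split.
Qed.

Lemma block_valid k : valid (level (state_at k)) (block (state_at k)).
Proof.
have [_ [vl _]] := state_inv k; case: (state_at k) vl => [[n h] [|u l]] //= vl.
by inversion vl.
Qed.

Lemma current_next k c : current (state_at k.+1) c =
  current (state_at k) (turn (block (state_at k)).1 (block (state_at k)).2 c).
Proof. by rewrite /state_at iterS -/(state_at k); case: (state_at k) => [[n h] [|u l]]. Qed.

Lemma level_next k : level (state_at k) <= level (state_at k.+1).
Proof. by rewrite /state_at iterS -/(state_at k); case: (state_at k) => [[n h] [|u l]] /=. Qed.

(** Induction on the number of blocks left in a level: when none is left, [good_word] is the desired
    agreement. *)
Lemma level_reached m : exists k, level (state_at k) = m.+1 /\
  agree rk m.+1 (current (state_at k)) g.
Proof.
suff H k : exists k', level (state_at k') = (level (state_at k)).+1 /\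
    agree rk (level (state_at k)).+1 (current (state_at k')) g.
  elim: m => [|m [k [e _]]]; first exact: (H 0).
  by have := H k; rewrite e.
have [l el] : exists l, (state_at k).2 = l by exists (state_at k).2.
elim: l k el => [|u l IH] k el.
  exists k.+1; have [_ [_]] := state_inv k.
  rewrite /state_at iterS -/(state_at k).
  by case: (state_at k) el => [[n h] l'] /= ->.
have el' : (state_at k.+1).2 = l.
  by rewrite /state_at iterS -/(state_at k); case: (state_at k) el => [[n h] l'] /= ->.
have lvl : level (state_at k.+1) = level (state_at k).
  by rewrite /state_at iterS -/(state_at k); case: (state_at k) el => [[n h] l'] /= ->.
have [k'] := IH _ el'; rewrite lvl => h.
by exists k'.
Qed.

(** Stronger than [low]: all finite coordinates are small, so from level m on only face twists move
    the cell. *)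
Definition below (m : nat) (c : Cell) : Prop :=
  forall i a, coordU i (sval c) = Fin a -> idx a < m.

Lemma below_rot m r c : below m c -> below m (rotC r c).
Proof.
move=> h.
have hx := h AX; have hy := h AY; have hz := h AZ.
have N b : (forall a, b = Fin a -> idx a < m) -> forall a, negB b = Fin a -> idx a < m.
  by case: b => [b||] //= hb a [<-]; rewrite idx_neg; exact: hb.
move=> i; case: c hx hy hz {h} => [[[x y] z] hc] /= hx hy hz.
have nx := N _ hx; have ny := N _ hy; have nz := N _ hz.
by case: r => [[[[]|] []] [[] []]]; case: i.
Qed.

Lemma below_exists c : exists m, below m.+1 c.
Proof.
pose d (be : Bar) := if be is Fin a then idx a else 0.
case: c => [[[x y] z] hc]; exists (d x + d y + d z) => i a /= e.
by case: i e => /= ->; rewrite /d ltnS; lia.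
Qed.

Lemma below_low m c : below m c -> low rk m c.
Proof.
case: c => [[[x y] z] hc] h; move: (h AX) (h AY) (h AZ); rewrite /low /=.
by case: x hc {h} => [x||]; case: y => [y||]; case: z => [z||] //= _ hx hy hz;
  rewrite !negb_and -!ltnNge; rewrite ?(hx _ erefl) ?(hy _ erefl) ?(hz _ erefl) ?orbT.
Qed.

Lemma face_turn i al c : al = PInf L \/ al = NInf L -> g (turn i (slice al) c) = g c.
Proof.
case: g_std => _ gf hal; rewrite -(gf i al hal).
exact: (act_iter (quarter i al)).
Qed.

Definition stage_config (n k : nat) : config :=
  block_config (level (state_at n)) (block (state_at n)) (current (state_at n)) k.

(** From [n0] on, only faces move the cells below m + 1. Face twists permute these cells and fix
    [g], so agreement persists through twists, and through limits by [block_limit]. *)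
Lemma settled m n0 : level (state_at n0) = m.+1 -> agree rk m.+1 (current (state_at n0)) g ->
  forall n k c, n0 <= n -> below m.+1 c -> stage_config n k c = g c.
Proof.
move=> lv0 ag0.
have lv n : n0 <= n -> m.+1 <= level (state_at n).
  elim: n => [|n IH]; first by rewrite leqn0 => /eqP e; rewrite -lv0 e.
  rewrite leq_eqVlt => /orP[/eqP <-|h]; first by rewrite lv0.
  exact: leq_trans (IH h) (level_next n).
have step n : n0 <= n -> (forall c, below m.+1 c -> current (state_at n) c = g c) ->
    forall k c, below m.+1 c -> stage_config n k c = g c.
  move=> hn hcur; elim=> [|k IH] c hc; first exact: hcur.
  rewrite /stage_config /= actE; set t := block_twist _ _ _.
  have lt : late m.+1 (bal t).
    have : late (level (state_at n)) (bal t).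
      by rewrite /t /block_twist; case: ifP => _; exact: slices_late.
    by case: (bal t) => //= a; apply: leq_trans; exact: lv.
  case e : (bal t) lt => [a||] lt.
  - rewrite iter_turn /slice; case: bar_eqbP => [/hc|_]; last exact: IH.
    by move=> h; move: lt; rewrite /= leqNgt h.
  - elim: (3 - bk t) c hc => [|j IHj] c hc; first exact: IH.
    rewrite iterSr IHj ?face_turn //; first by left.
    by have [r ->] := turn_rot (bax t) (slice (PInf L)) c; exact: below_rot.
  - elim: (3 - bk t) c hc => [|j IHj] c hc; first exact: IH.
    rewrite iterSr IHj ?face_turn //; first by right.
    by have [r ->] := turn_rot (bax t) (slice (NInf L)) c; exact: below_rot.
suff H n : n0 <= n -> forall c, below m.+1 c -> current (state_at n) c = g c.
  by move=> n k c hn; exact: (step n hn (H n hn)).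
elim: n => [|n IH].
  by rewrite leqn0 => /eqP e c hc; rewrite -e; apply: ag0; rewrite below_low ?orbT.
rewrite leq_eqVlt => /orP[/eqP <-|hn] c hc; first by apply: ag0; rewrite below_low ?orbT.
have [K hK] := block_limit (current (state_at n)) c (block_valid (k := n)).
rewrite current_next -(hK K (leqnn _)); exact: (step n hn (IH hn)).
Qed.

Definition stage_of (eta : option (nat * nat)) : config :=
  if eta is Some (n, k) then stage_config n k else g.

(** Eventual values are unique, as two thresholds are comparable; it suffices to exhibit the
    prescribed one. *)
Lemma eventually_const_limit (I : wellorder) (G : option I -> config) eta c :
  eventually_const G eta c (G eta c) ->
  (forall v, eventually_const G eta c v -> G eta c = v) /\
  ((forall v, ~ eventually_const G eta c v) -> G eta c = None).
Proof.
move=> h; split=> [v [b [hb bv]]|no]; last by case: (no _ h).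
case: h => b' [hb' bv'].
by case: (sle_total b b') => le; [rewrite -(bv b')|rewrite -(bv' b)] => //;
   [rewrite (bv' b') //; right|rewrite (bv b) //; right].
Qed.

Lemma accessible_standard_face : accessible_le_w2 f g.
Proof.
pose s (x : omega2) : btwist L :=
  block_twist (level (state_at x.1)) (block (state_at x.1)) x.2.
exists omega2, s, stage_of; split; last by split; first by exists id.
move=> [[n k]|]; (split; [|split]).
- move=> no c; case: k no => [|k] no; last by case: (no (Some (n, k))); right; split=> /=.
  by case: n no => [|n] no //; case: (no (Some (n, 0))); left=> /=.
- move=> [n' k'] /= lt no c.
  have [e1 e2] : n = n' /\ k = k'.+1.
    case: lt => /= [lt|[e lt]].
      by case: (no (Some (n', k'.+1))); split; [right|left].
    split=> //; apply/eqP; rewrite eqn_leq lt andbT leqNgt; apply/negP => lt'.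
    by case: (no (Some (n', k'.+1))); split; right; split=> /=.
  by rewrite e1 e2.
- move=> [b hb] lim c; apply: eventually_const_limit.
  (* The stage (n, k + 1) is a successor, not a limit. *)
  case: k lim hb => [|k] lim hb; last first.
    have [|[[n' k']|] [h1 h2]] := lim (n, k); [by right; split=> /=| |by []].
    have {}h1 : lexlt (n, k) (n', k') := h1.
    have {}h2 : lexlt (n', k') (n, k.+1) := h2.
    by move: h1 h2; rewrite /lexlt /=; lia.
  case: n lim hb => [|n] lim hb; first by case: b hb => [[n' k']|] //= [|[]].
  (* The limit stage (n + 1, 0) closes block n. *)
  have [K hK] := block_limit (current (state_at n)) c (block_valid (k := n)).
  exists (Some (n, K)); split; first by left=> /=.
  move=> [[n' k']|] //= le lt.
  have {}lt : lexlt (n', k') (n.+1, 0) := lt.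
  have [-> lek] : n' = n /\ K <= k'.
    case: le lt => [le|[-> ->]]; last by [].
    have {}le : lexlt (n, K) (n', k') := le.
    by move: le; rewrite /lexlt /=; lia.
  by rewrite /stage_config hK // -current_next.
- by move=> no; case: (no (Some (0, 0))).
- move=> [n k] _ no; case: (no (Some (n, k.+1))); split=> //.
  by right; split=> /=.
(* At the end, the color of each cell is constant once a level above all its indices is reached. *)
- move=> _ _ c; apply: eventually_const_limit.
  have [m hm] := below_exists c; have [n0 [lv ag]] := level_reached m.
  exists (Some (n0, 0)); split=> // -[[n k]|] //= le _.
  apply: (settled lv ag) => //.
  by case: le => [[/= /ltnW|[/= ->]]|[->]].
Qed.

End OmegaSquare.

(** * Strictness of the inclusion and conclusion *)

Definition unit_order : wellorder.
Proof.
apply: (@WO unit (fun _ _ => False)).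
- by move=> a [].
- by move=> a b c [].
- by move=> [] []; right; left.
- by constructor=> b [].
Defined.

Lemma accessible_act (L : eqType) (t : btwist L) (f : config L) : accessible f (act t f).
Proof.
exists unit_order, (fun _ => t), (fun eta => if eta is Some _ then f else act t f).
split; last by [].
move=> [[]|]; (split; [|split]).
- by [].
- by move=> [] [].
- by move=> [[[]|[]]].
- by move=> no; case: (no (Some tt)).
- by move=> [].
- by move=> _ lim; have [|[[]|] [[]]] := lim tt.
Qed.

(** Turning the slice y = l, with l nonzero, makes the cell (+oo, l, 0) white, while the quarter
    turn of the face x = +oo brings a red cell there. *)
Lemma accessible_not_face_fixed (L : eqType) (l : L) :
  exists f : config L, L_solved f /\ ~ face_fixed f.
Proof.
pose t := quarter AY (Fin (LPos l)).
exists (act t (@f_solved L)); split; first split.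
- by case: (standard_solved L) => lf _ c; exact: lf.
- exact: accessible_act.
move=> /(_ AX (PInf L) (or_introl erefl) (face (LPos l) (LZero L))).
by rewrite !actE !iter_turn /slice /= eqxx.
Qed.

Theorem theorem5p10 (L : eqType) (hL : exists g : nat -> L, bijective g) :
  (* (1) S^face ⊊ L[f_solved] ⊆ S *)
  ((forall f : config L, standard_face f -> L_solved f) /\
   (exists f : config L, L_solved f /\ ~ standard_face f) /\
   (forall f : config L, L_solved f -> standard f)) /\
  (* (2) *)
  (forall f g : config L, standard f -> standard_face g -> accessible_le_w2 f g) /\
  (* (3) *)
  (forall f g : config L, legal g -> ~ standard g -> standard f ->
     ~ accessible f g /\ ~ accessible g f).
Proof.
have [en [rk enK rkK]] := hL.
have reach (f g : config L) : standard f -> standard_face g -> accessible_le_w2 f g.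
  by move=> sf sg; apply: (accessible_standard_face enK rkK sf sg).
have solved := standard_solved L; have [legal_solved _] := solved.
split; [split; [|split]|split=> //].
- move=> f face_f; have [[legal_f _] _] := face_f; split=> //.
  have [I [s [F [run [_ e]]]]] := reach _ _ solved face_f.
  by exists I, s, F.
- have [f [Lf nf]] := accessible_not_face_fixed (en 0).
  by exists f; split=> // -[_ /nf].
- by move=> f [legal_f acc]; apply/(accessible_standard acc legal_solved legal_f).
- move=> f g legal_g ng std_f; have [legal_f _] := std_f.
  by split=> acc; apply: ng; apply/(accessible_standard acc).
Qed.
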